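(* Let $n\ge 1$, $d=2^n$, and let $U$ be a fixed $d\times d$ unitary. The cost functions $C_{HST}$ and $C_{LHST}$ of full unitary matrix compiling exhibit strong Optimal Parameter Resilience (strong-OPR) to Noise Model 2. That is, for every choice of the noise channels, noise parameters and factorizations allowed in Noise Model 2 (spelled out in the context), if $\widetilde C_{HST}$ and $\widetilde C_{LHST}$ denote the corresponding noisy cost functions on the set $\mathbb V_d$ of all $d\times d$ unitary matrices, then $$\{V'\in\mathbb V_d:\widetilde C_{HST}(V')=\min_{V\in\mathbb V_d}\widetilde C_{HST}(V)\}=\{V'\in\mathbb V_d: C_{HST}(V')=\min_{V\in\mathbb V_d}C_{HST}(V)\}$$ and $$\{V'\in\mathbb V_d:\widetilde C_{LHST}(V')=\min_{V\in\mathbb V_d}\widetilde C_{LHST}(V)\}=\{V'\in\mathbb V_d: C_{LHST}(V')=\min_{V\in\mathbb V_d}C_{LHST}(V)\}.$$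
   Context: **Systems and costs.** $A=A_1\cdots A_n$ and $B=B_1\cdots B_n$ are $n$-qubit systems; $\mathbb V_d$ is the set of $d\times d$ unitaries, $d=2^n$; $U$ is the fixed target, $V\in\mathbb V_d$ the trainable unitary, $W=V^\dagger U$ (acting on $A$). A calligraphic letter denotes conjugation by the unitary, e.g. $\mathcal W(\rho)=W\rho W^\dagger$. The entangling gate $E$ on $AB$ applies a Hadamard gate to each $A_j$ and then, for each $j$, a CNOT with control $A_j$ and target $B_j$, so that $E|\mathbf 0\rangle$ is the standard maximally entangled state of $AB$. $E^{(j)}$ is the part of $E$ acting on $A_jB_j$ (Hadamard on $A_j$, then CNOT). The Hilbert-Schmidt Test (HST) circuit prepares all $2n$ qubits in $|0\rangle$, applies $E$, then $W=V^\dagger U$ on $A$, then $E^\dagger$, then measures all qubits in the standard basis; $F_{HST}(V)=|\mathrm{Tr}(V^\dagger U)|^2/d^2$ is the probability of the all-zeros outcome and $C_{HST}=1-F_{HST}$. The Local HST (LHST) circuit for index $j$ is the same except that $E^\dagger$ is replaced by $(E^{(j)})^\dagger$ and only $A_j,B_j$ are measured; $F^{(j)}_{LHST}(V)$ is the probability of outcome $00$, and $C_{LHST}=1-\frac1n\sum_{j=1}^nF^{(j)}_{LHST}$. **Noise types.** For an $m$-qubit system and $\mathbf l,\mathbf k\in\{0,1\}^m$ put $X^{\mathbf l}Z^{\mathbf k}=\sigma_x^{l_1}\sigma_z^{k_1}\otimes\cdots\otimes\sigma_x^{l_m}\sigma_z^{k_m}$. (DN) Depolarizing noise: $\rho\mapsto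 p\rho+(1-p)\mathbb 1/2^m$ for states $\rho$, with $p\in[0,1]$ (extended linearly; if applied to a subsystem $A$ of $AB$ it acts as this map on $A$ tensored with the identity channel on $B$). (PN) Pauli noise: a CPTP map $\mathcal P$ with $\mathcal P(X^{\mathbf l}Z^{\mathbf k})=c_{\mathbf l\mathbf k}X^{\mathbf l}Z^{\mathbf k}$ for all $\mathbf l,\mathbf k$, with $c_{\mathbf 0\mathbf 0}=1$ and all $c_{\mathbf l\mathbf k}\ge 0$. (NUPN) Non-unital Pauli noise: a CPTP map $\mathcal P_{NU}$ with $\mathcal P_{NU}(\mathbb 1)=\mathbb 1+\sum_{(\mathbf l,\mathbf k)\ne(\mathbf 0,\mathbf 0)}d_{\mathbf l\mathbf k}X^{\mathbf l}Z^{\mathbf k}$ and $\mathcal P_{NU}(X^{\mathbf l}Z^{\mathbf k})=c_{\mathbf l\mathbf k}X^{\mathbf l}Z^{\mathbf k}$ for $(\mathbf l,\mathbf k)\ne(\mathbf 0,\mathbf 0)$, with all $c_{\mathbf l\mathbf k}\ge0$. (PGN) Pauli gate noise: each gate channel $\mathcal G$ is replaced by $\mathcal P'\circ\mathcal G\circ\mathcal P$ with $\mathcal P,\mathcal P'$ PN channels acting on all qubits of the circuit (they may differ from gate to gate). (MN) Measurement noise: for each measured qubit $q$ the projector $|0\rangle\langle0|$ is replaced by $\widetilde P_0^{(q)}=p^{(q)}_{00}|0\rangle\langle0|+p^{(q)}_{01}|1\rangle\langle1|$, where $p^{(q)}_{kl}\in[0,1]$ is the probability of outcome $k$ given input $l$,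 $p^{(q)}_{00}+p^{(q)}_{10}=1=p^{(q)}_{01}+p^{(q)}_{11}$, $p^{(q)}_{00}>p^{(q)}_{01}$ and $p^{(q)}_{11}>p^{(q)}_{10}$; for several qubits one takes tensor products. **Noise Model 2.** Noise acting ''continuously'' means channels interleaved between finitely many time steps. All noise channels and the number of steps are fixed independently of $V$. (i) Initial state $|\mathbf 0\rangle\langle\mathbf 0|$ on $AB$. (ii) The gates of $E$ are applied with PGN, and each noisy gate is followed by a DN channel on $AB$. (iii) At time $\tau_1$ (just before $W$): a PN channel $\mathcal Q^{AB}$ on $AB$, followed by a NUPN channel $\mathcal P^A_{NU}$ on $A$. (iv) Between $\tau_1$ and $\tau_2$: for each $V$, a factorization $W=W_l\cdots W_1$ into $l$ unitaries on $A$ is used, and step $i=1,\dots,l$ applies $\mathcal D^{AB}_i\circ\mathcal D^A_i\circ(\mathcal W_i\otimes\widehat{\mathcal P}^B_{i})$, with $\mathcal D_i^{AB}$ a DN channel on $AB$, $\mathcal D^A_i$ a DN channel on $A$, $\widehat{\mathcal P}^B_{i}$ a PN channel on $B$. (v) At time $\tau_2$ (just after $W$): a PN channel $\widehat{\mathcal Q}^{AB}$ on $AB$. (vi) The gates of $E^\dagger$ (for LHST: of $(E^{(j)})^\dagger$, with noise channels that may depend on $j$) are applied with PGN, each noisy gate followed by a DN channel on $AB$. (vii) Measurement with MN: $\widetilde F_{HST}(V)$ is the expectation of $\bigotimes_q\widetilde P_0^{(q)}$ over all $2n$ qubits; $\widetilde F^{(j)}_{LHST}(V)$ is the expectation of $\widetilde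 P_0^{(A_j)}\otimes\widetilde P_0^{(B_j)}\otimes\mathbb 1$. The noisy costs are $\widetilde C_{HST}=1-\widetilde F_{HST}$ and $\widetilde C_{LHST}=1-\frac1n\sum_j\widetilde F^{(j)}_{LHST}$. **Strong-OPR.** A cost $C$ on $\mathbb V_d$ exhibits strong-OPR to a noise process if the set of minimizers over $\mathbb V_d$ of its noisy version $\widetilde C$ equals the set of minimizers of $C$.
   Formalization: Equality of minimizer sets is proved assuming all depolarizing parameters p and all Pauli coefficients c_lk are strictly positive (with p = 0 the noisy costs are constant and the claim fails); for arbitrary noise only the inclusion of noiseless in noisy minimizers is proved. *)

(* Defs.v *)
(* Complex matrices are matrices over R[i] with R : realType. *)
From mathcomp Require Import all_boot all_order all_algebra.
From mathcomp Require Import boolp classical_sets reals.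
From mathcomp Require Import complex mxtens.

Set Implicit Arguments.
Unset Strict Implicit.
Unset Printing Implicit Defensive.

Import Order.TTheory GRing.Theory Num.Theory.

Local Open Scope ring_scope.
Local Open Scope sesquilinear_scope.
Local Open Scope complex_scope.

Section Operators.
Variable R : realType.
Local Notation C := R[i].

Definition conjugate D (G : 'M[C]_D) (rho : 'M[C]_D) : 'M[C]_D :=
  G *m rho *m G ^t*.

(* The order of R[i] makes 0 <= z mean "z is real and nonnegative", so this
   also forces rho to be Hermitian. *)
Definition psd D (rho : 'M[C]_D) : Prop :=
  forall v : 'rV[C]_D, 0 <= (v *m rho *m v ^t*) 0 0.

(* Phi (x) Psi for linear Phi and Psi, by expansion in matrix units. *)
Definition tens_chan a b (Phi : 'M[C]_a -> 'M[C]_a) (Psi : 'M[C]_b -> 'M[C]_b)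
    (rho : 'M[C]_(a * b)) : 'M[C]_(a * b) :=
  \sum_(i < a * b) \sum_(j < a * b) rho i j *:
    (Phi (delta_mx (mxtens_unindex i).1 (mxtens_unindex j).1) *t
     Psi (delta_mx (mxtens_unindex i).2 (mxtens_unindex j).2)).

Definition cptp D (Phi : {linear 'M[C]_D -> 'M[C]_D}) : Prop :=
  (forall rho, \tr (Phi rho) = \tr rho) /\
  (forall k (rho : 'M[C]_(D * k)), psd rho -> psd (tens_chan Phi idfun rho)).

(* The linear extension of rho |-> p rho + (1 - p) 1/D from states. *)
Definition depol D (p : R) (rho : 'M[C]_D) : 'M[C]_D :=
  p%:C *: rho + ((1 - p)%:C * \tr rho / D%:R) *: 1%:M.

Definition valid_depol (p : R) : Prop := 0 <= p <= 1.

(* In the next three definitions P is the family of all Pauli strings X^l Z^k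
   of the system, indexed by their labels, and P e = 1. *)
Definition pauli_noise D (I : finType) (e : I) (P : I -> 'M[C]_D)
    (Phi : {linear 'M[C]_D -> 'M[C]_D}) : Prop :=
  cptp Phi /\
  exists c : I -> R, [/\ c e = 1, forall i, 0 <= c i
                       & forall i, Phi (P i) = (c i)%:C *: P i].

Definition nu_pauli_noise D (I : finType) (e : I) (P : I -> 'M[C]_D)
    (Phi : {linear 'M[C]_D -> 'M[C]_D}) : Prop :=
  cptp Phi /\
  exists (c : I -> R) (d : I -> C),
    [/\ Phi 1%:M = 1%:M + \sum_(i | i != e) d i *: P i,
        forall i, i != e -> 0 <= c i
      & forall i, i != e -> Phi (P i) = (c i)%:C *: P i].

Definition kills_no_pauli D (I : finType) (P : I -> 'M[C]_D)
    (Phi : {linear 'M[C]_D -> 'M[C]_D}) : Prop :=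
  forall i, Phi (P i) <> 0.

Definition ketbra0 : 'M[C]_2 := delta_mx 0 0.
Definition ketbra1 : 'M[C]_2 := delta_mx 1 1.
Definition sigma_x : 'M[C]_2 := delta_mx 0 1 + delta_mx 1 0.
Definition sigma_z : 'M[C]_2 := ketbra0 - ketbra1.
Definition hadamard : 'M[C]_2 :=
  ((Num.sqrt 2%:R)^-1 : R)%:C *: (sigma_x + sigma_z).

(* p k l is the probability of reading k when the qubit is in state l. *)
Definition readout := 'I_2 -> 'I_2 -> R.

Definition valid_readout (p : readout) : Prop :=
  [/\ forall k l, 0 <= p k l <= 1, forall l, p 0 l + p 1 l = 1,
      p 0 1 < p 0 0 & p 1 0 < p 1 1].

Definition readout0 (p : readout) : 'M[C]_2 :=
  (p 0 0)%:C *: ketbra0 + (p 0 1)%:C *: ketbra1.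

Section Qubits.
Variable n : nat.
Local Notation opA := 'M[C]_(2 ^ n).
Local Notation opAB := 'M[C]_(2 ^ n * 2 ^ n).

(* Qubit j of the basis state i is a binary digit of i, qubit 0 being the most
   significant one, as for iterated Kronecker products. *)
Definition qbit (i : 'I_(2 ^ n)) (j : 'I_n) : 'I_2 :=
  inZp (i %/ 2 ^ rev_ord j)%N.

(* M 0 (x) ... (x) M (n - 1) *)
Definition tens_qubits (M : 'I_n -> 'M[C]_2) : opA :=
  \matrix_(i, k) \prod_(j < n) M j (qbit i j) (qbit k j).

Definition on_qubit (j : 'I_n) (G : 'M[C]_2) : opA :=
  tens_qubits (fun i => if i == j then G else 1%:M).

(* A label is the pair (l, k) of exponents in X^l Z^k. *)
Definition pauli_label : finType :=
  ({ffun 'I_n -> bool} * {ffun 'I_n -> bool})%type.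
Definition label0 : pauli_label := ([ffun=> false], [ffun=> false]).

Definition pauli (a : pauli_label) : opA :=
  tens_qubits (fun j => sigma_x ^+ a.1 j *m sigma_z ^+ a.2 j).

Definition pauliAB (ab : pauli_label * pauli_label) : opAB :=
  pauli ab.1 *t pauli ab.2.

Definition PN_A := pauli_noise label0 pauli.
Definition PN_AB := pauli_noise (label0, label0) pauliAB.
Definition NUPN_A := nu_pauli_noise label0 pauli.

Definition gateH (j : 'I_n) : opAB := on_qubit j hadamard *t 1%:M.

(* Control A_j, target B_j. *)
Definition gateCNOT (j : 'I_n) : opAB :=
  on_qubit j ketbra0 *t 1%:M + on_qubit j ketbra1 *t on_qubit j sigma_x.

Definition zero_state : opAB :=
  tens_qubits (fun=> ketbra0) *t tens_qubits (fun=> ketbra0).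

Definition minimizers (cost : opA -> R) : set opA :=
  [set V | V \is unitarymx /\
           forall V', V' \is unitarymx -> cost V <= cost V']%classic.

(* The first argument is the noiseless cost, the second its noisy version. *)
Definition strong_OPR (cost noisy : opA -> R) : Prop :=
  minimizers noisy = minimizers cost.

Section Noiseless.
Variable U : opA.

Definition C_HST (V : opA) : R :=
  1 - complex.Re (`|\tr (V ^t* *m U)| ^+ 2 / (2 ^ n)%:R ^+ 2).

Definition run (gs : seq opAB) (rho : opAB) : opAB :=
  foldl (fun sigma G => conjugate G sigma) rho gs.

Definition F_LHST (j : 'I_n) (V : opA) : R :=
  complex.Re (\tr ((on_qubit j ketbra0 *t on_qubit j ketbra0) *m
    run ([seq gateH i | i <- enum 'I_n] ++ [seq gateCNOT i | i <- enum 'I_n] ++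
         [:: (V ^t* *m U) *t 1%:M; (gateCNOT j) ^t*; (gateH j) ^t*])
      zero_state)).

Definition C_LHST (V : opA) : R := 1 - n%:R^-1 * \sum_(j < n) F_LHST j V.

End Noiseless.

Record gate_noise := GateNoise {
  pre : {linear opAB -> opAB};
  post : {linear opAB -> opAB};
  gdep : R }.

Definition noisy_gate (GN : opAB * gate_noise) (rho : opAB) : opAB :=
  depol (gdep GN.2) (post GN.2 (conjugate GN.1 (pre GN.2 rho))).

Definition noisy_run (gs : seq (opAB * gate_noise)) (rho : opAB) : opAB :=
  foldl (fun sigma GN => noisy_gate GN sigma) rho gs.

(* factor V i is the (i + 1)-th unitary W_(i+1) in the factorization
   V^* U = W_l ... W_1, with l = steps; everything else is independent of V. *)
Record noise := Noise {
  prepH : 'I_n -> gate_noise;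
  prepCNOT : 'I_n -> gate_noise;
  Q1 : {linear opAB -> opAB};
  PNU : {linear opA -> opA};
  steps : nat;
  factor : opA -> 'I_steps -> opA;
  depA : 'I_steps -> R;
  depAB : 'I_steps -> R;
  PB : 'I_steps -> {linear opA -> opA};
  Q2 : {linear opAB -> opAB};
  hstCNOT : 'I_n -> gate_noise;
  hstH : 'I_n -> gate_noise;
  lhstCNOT : 'I_n -> gate_noise;
  lhstH : 'I_n -> gate_noise;
  readA : 'I_n -> readout;
  readB : 'I_n -> readout }.
Arguments factor : clear implicits.
Arguments depA : clear implicits.
Arguments depAB : clear implicits.
Arguments PB : clear implicits.

Definition valid_gate_noise (g : gate_noise) : Prop :=
  [/\ PN_AB (pre g), PN_AB (post g) & valid_depol (gdep g)].

Definition noise_model2 (U : opA) (N : noise) : Prop :=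
  [/\ forall j, [/\ valid_gate_noise (prepH N j),
          valid_gate_noise (prepCNOT N j), valid_gate_noise (hstCNOT N j)
        & valid_gate_noise (hstH N j)],
      forall j, [/\ valid_gate_noise (lhstCNOT N j),
          valid_gate_noise (lhstH N j), valid_readout (readA N j)
        & valid_readout (readB N j)],
      [/\ PN_AB (Q1 N), NUPN_A (PNU N) & PN_AB (Q2 N)],
      forall i, [/\ valid_depol (depA N i), valid_depol (depAB N i)
        & PN_A (PB N i)]
    & forall V, V \is unitarymx ->
        (forall i, factor N V i \is unitarymx) /\
        V ^t* *m U =
          \big[mulmx/1%:M]_(i < steps N) factor N V (rev_ord i)].

Definition informative_gate_noise (g : gate_noise) : Prop :=
  [/\ kills_no_pauli pauliAB (pre g), kills_no_pauli pauliAB (post g)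
    & 0 < gdep g].

(* Valid noise may have p = 0 or c_lk = 0.  A single completely depolarizing
   step makes both noisy costs constant, so that every unitary minimizes them;
   "informative" excludes such information loss.  For valid noise it says that
   all the p and all the c_lk are positive. *)
Definition informative (N : noise) : Prop :=
  [/\ forall j, [/\ informative_gate_noise (prepH N j),
          informative_gate_noise (prepCNOT N j),
          informative_gate_noise (hstCNOT N j)
        & informative_gate_noise (hstH N j)],
      forall j, informative_gate_noise (lhstCNOT N j) /\
        informative_gate_noise (lhstH N j),
      [/\ kills_no_pauli pauliAB (Q1 N), kills_no_pauli pauli (PNU N)
        & kills_no_pauli pauliAB (Q2 N)]
    & forall i, [/\ 0 < depA N i, 0 < depAB N i
        & kills_no_pauli pauli (PB N i)]].

Section Noisy.
Variable N : noise.

Definition noisy_step (V : opA) (rho : opAB) (i : 'I_(steps N)) : opAB :=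
  depol (depAB N i)
    (tens_chan (depol (depA N i)) idfun
      (tens_chan (conjugate (factor N V i)) (PB N i) rho)).

(* The state right after Q2, that is, before the gates of E^* or (E^(j))^*. *)
Definition noisy_middle (V : opA) : opAB :=
  let prepared := noisy_run
    ([seq (gateH j, prepH N j) | j <- enum 'I_n] ++
     [seq (gateCNOT j, prepCNOT N j) | j <- enum 'I_n]) zero_state in
  let start := tens_chan (PNU N) idfun (Q1 N prepared) in
  Q2 N (foldl (noisy_step V) start (enum 'I_(steps N))).

Definition noisy_F_HST (V : opA) : R :=
  complex.Re (\tr (
    (tens_qubits (fun j => readout0 (readA N j)) *t
     tens_qubits (fun j => readout0 (readB N j))) *m
    noisy_run
      ([seq ((gateCNOT j) ^t*, hstCNOT N j) | j <- rev (enum 'I_n)] ++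
       [seq ((gateH j) ^t*, hstH N j) | j <- rev (enum 'I_n)])
      (noisy_middle V))).

Definition noisy_F_LHST (j : 'I_n) (V : opA) : R :=
  complex.Re (\tr (
    (on_qubit j (readout0 (readA N j)) *t on_qubit j (readout0 (readB N j))) *m
    noisy_run
      [:: ((gateCNOT j) ^t*, lhstCNOT N j); ((gateH j) ^t*, lhstH N j)]
      (noisy_middle V))).

Definition noisy_C_HST (V : opA) : R := 1 - noisy_F_HST V.

Definition noisy_C_LHST (V : opA) : R :=
  1 - n%:R^-1 * \sum_(j < n) noisy_F_LHST j V.

End Noisy.
End Qubits.
End Operators.

Arguments factor {R n} _ _ _.
Arguments depA {R n} _ _.
Arguments depAB {R n} _ _.
Arguments PB {R n} _ _.

(* Main.v *)
Require Import Defs.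
From HB Require Import structures.
From mathcomp Require Import all_boot all_order all_algebra.
From mathcomp Require Import boolp classical_sets reals complex mxtens.
From mathcomp Require Import ring.

(* Write M' for the adjoint of M and W = V' U.  Every gate of E is Clifford and
   every PN or DN channel scales each Pauli string P_a by a nonnegative factor,
   so a noisy run scales the noiseless run of P_a.  Since E maps Z^k (x) Z^l to
   P (x) P with P = X^k Z^l, both the prepared state and the pulled-back
   observable are nonnegative combinations of the P_a (x) P_a, and each noisy
   fidelity has the form
     sum_a w_a Re tr (P_a' W P_a W'),  w_a >= 0 independent of V.
   The displacement caused by non-unital noise is traceless on A and is paired
   with the identity on B, so it drops out.  As W P_a W' and P_a are unitary,
   2 (d - Re tr (P_a' W P_a W')) = |W P_a W' - P_a|^2, so V is optimal iff W
   commutes with every P_a of positive weight.  The noiseless costs have the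
   same form (sum_a tr (P_a' W P_a W') = d |tr W|^2), with enough positive
   weights to force W to commute with all P_a; so does informative noise. *)

Set Implicit Arguments.
Unset Strict Implicit.
Unset Printing Implicit Defensive.

Import Order.TTheory GRing.Theory Num.Theory.

Local Open Scope ring_scope.
Local Open Scope sesquilinear_scope.
Local Open Scope complex_scope.

(** * Adjoints, tensor products and channels *)

Section Adjoint.
Variable K : numClosedFieldType.

Lemma adjmxM m n p (A : 'M[K]_(m, n)) (B : 'M[K]_(n, p)) :
  (A *m B) ^t* = B ^t* *m A ^t*.
Proof. by rewrite trmx_mul map_mxM. Qed.

Lemma adjmxD m n (A B : 'M[K]_(m, n)) : (A + B) ^t* = A ^t* + B ^t*.
Proof. by rewrite linearD map_mxD. Qed.

Lemma adjmxB m n (A B : 'M[K]_(m, n)) : (A - B) ^t* = A ^t* - B ^t*.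
Proof. by rewrite linearB map_mxB. Qed.

Lemma adjmxZ m n a (A : 'M[K]_(m, n)) : (a *: A) ^t* = (a^*)%R *: A ^t*.
Proof. by rewrite linearZ map_mxZ. Qed.

Lemma adjmx1 n : (1%:M : 'M[K]_n) ^t* = 1%:M.
Proof. by rewrite trmx1 map_mx1. Qed.

Lemma adjmx_delta m n i j : (delta_mx i j : 'M[K]_(m, n)) ^t* = delta_mx j i.
Proof. by rewrite trmx_delta map_delta_mx. Qed.

Lemma adjmx_tens m n p q (A : 'M[K]_(m, n)) (B : 'M[K]_(p, q)) :
  (A *t B) ^t* = A ^t* *t B ^t*.
Proof. by rewrite trmx_tens map_mxT. Qed.

Lemma tr_adjmx n (A : 'M[K]_n) : \tr (A ^t*) = ((\tr A)^*)%R.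
Proof.
by rewrite /mxtrace rmorph_sum; apply: eq_bigr => i _; rewrite !mxE.
Qed.

Lemma conj_unitary n (A B : 'M[K]_n) :
  A \is unitarymx -> B \is unitarymx -> A *m B *m A ^t* \is unitarymx.
Proof. by move=> Au Bu; rewrite !mul_unitarymx ?trmxC_unitary. Qed.

Lemma adj_mul_unitary n (A B : 'M[K]_n) :
  A \is unitarymx -> B \is unitarymx -> A ^t* *m B \is unitarymx.
Proof. by move=> Au Bu; rewrite mul_unitarymx ?trmxC_unitary. Qed.

Lemma tr_adjmx_mul m n (A : 'M[K]_(m, n)) :
  \tr (A *m A ^t*) = \sum_i \sum_j `|A i j| ^+ 2.
Proof.
apply: eq_bigr => i _; rewrite !mxE; apply: eq_bigr => j _.
by rewrite !mxE normCK.
Qed.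

Lemma tr_adjmx_mul_ge0 m n (A : 'M[K]_(m, n)) : 0 <= \tr (A *m A ^t*).
Proof.
by rewrite tr_adjmx_mul; do 2![apply: sumr_ge0 => ? _]; rewrite exprn_ge0.
Qed.

Lemma tr_adjmx_mul_eq0 m n (A : 'M[K]_(m, n)) : \tr (A *m A ^t*) = 0 -> A = 0.
Proof.
rewrite tr_adjmx_mul => /eqP; rewrite psumr_eq0; last first.
  by move=> i _; apply: sumr_ge0 => j _; rewrite exprn_ge0.
move=> /allP A0; apply/matrixP => i j; rewrite mxE; apply/eqP.
have := A0 i (mem_index_enum _); rewrite psumr_eq0 /=; last first.
  by move=> k _; rewrite exprn_ge0.
by move=> /allP/(_ j (mem_index_enum _)); rewrite sqrf_eq0 normr_eq0.
Qed.

End Adjoint.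

Section TensorTheory.
Variable K : comPzRingType.

Lemma tensmxZl m n p q a (A : 'M[K]_(m, n)) (B : 'M[K]_(p, q)) :
  (a *: A) *t B = a *: (A *t B).
Proof. by apply/matrixP => i j; rewrite !mxE mulrA. Qed.

Lemma tensmxZr m n p q a (A : 'M[K]_(m, n)) (B : 'M[K]_(p, q)) :
  A *t (a *: B) = a *: (A *t B).
Proof. by apply/matrixP => i j; rewrite !mxE mulrCA. Qed.

Lemma tensmxDl m n p q (A A' : 'M[K]_(m, n)) (B : 'M[K]_(p, q)) :
  (A + A') *t B = A *t B + A' *t B.
Proof. by apply/matrixP => i j; rewrite !mxE mulrDl. Qed.

Lemma tensmx_suml m n p q (I : finType)
    (F : I -> 'M[K]_(m, n)) (B : 'M[K]_(p, q)) :
  (\sum_i F i) *t B = \sum_i F i *t B.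
Proof.
apply/matrixP => i j; rewrite mxE !summxE mulr_suml.
by apply: eq_bigr => k _; rewrite mxE.
Qed.

Lemma tensmx_sumr m n p q (I : finType)
    (A : 'M[K]_(m, n)) (F : I -> 'M[K]_(p, q)) :
  A *t (\sum_i F i) = \sum_i A *t F i.
Proof.
apply/matrixP => i j; rewrite mxE !summxE mulr_sumr.
by apply: eq_bigr => k _; rewrite mxE.
Qed.

Lemma tens1mx1 m n : (1%:M : 'M[K]_m) *t (1%:M : 'M[K]_n) = 1%:M.
Proof.
apply/matrixP => ik jl; case: (mxtens_indexP ik) => i k.
case: (mxtens_indexP jl) => j l.
rewrite tensmxE !mxE (can_eq (@mxtens_indexK m n)) xpair_eqE.
by rewrite -natrM mulnb.
Qed.

Lemma sum_mxtens (V : nmodType) m n (F : 'I_(m * n) -> V) :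
  \sum_i F i = \sum_i \sum_j F (mxtens_index (i, j)).
Proof.
rewrite pair_big (reindex (@mxtens_index m n)) /=; last first.
  exact/onW_bij/(Bijective (@mxtens_indexK m n) (@mxtens_unindexK m n)).
by apply: eq_bigr => -[i j] _.
Qed.

Lemma mxtrace_tens m n (A : 'M[K]_m) (B : 'M[K]_n) :
  \tr (A *t B) = \tr A * \tr B.
Proof.
rewrite /mxtrace sum_mxtens big_distrlr; apply: eq_bigr => i _ /=.
by apply: eq_bigr => j _; rewrite tensmxE.
Qed.
End TensorTheory.

Section TensChan.
Variable R : realType.
Local Notation C := R[i].

(** The coefficients of a product operator in the matrix units factor, so linearity of both maps
    collapses the defining double sum of [tens_chan]. This and linearity are how [tens_chan] is
    evaluated from here on. *)
Lemma tens_chanE a b (Phi : {linear 'M[C]_a -> 'M[C]_a})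
    (Psi : {linear 'M[C]_b -> 'M[C]_b}) A B :
  tens_chan Phi Psi (A *t B) = Phi A *t Psi B.
Proof.
have PhiE : Phi A = \sum_i \sum_j A i j *: Phi (delta_mx i j).
  rewrite {1}(matrix_sum_delta A) linear_sum; apply: eq_bigr => i _.
  by rewrite linear_sum; apply: eq_bigr => j _; rewrite linearZ.
have PsiE : Psi B = \sum_i \sum_j B i j *: Psi (delta_mx i j).
  rewrite {1}(matrix_sum_delta B) linear_sum; apply: eq_bigr => i _.
  by rewrite linear_sum; apply: eq_bigr => j _; rewrite linearZ.
rewrite PhiE PsiE tensmx_suml /tens_chan sum_mxtens; apply: eq_bigr => i _.
rewrite tensmx_sumr; apply: eq_bigr => k _.
rewrite sum_mxtens tensmx_suml; apply: eq_bigr => j _.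
rewrite tensmx_sumr; apply: eq_bigr => l _.
by rewrite !mxtens_indexK tensmxE /= tensmxZl tensmxZr scalerA.
Qed.

Fact tens_chan_is_linear a b (Phi : 'M[C]_a -> 'M[C]_a)
    (Psi : 'M[C]_b -> 'M[C]_b) : linear (tens_chan Phi Psi).
Proof.
move=> x A B; rewrite /tens_chan scaler_sumr -big_split; apply: eq_bigr => i _.
rewrite scaler_sumr -big_split; apply: eq_bigr => j _ /=.
by rewrite !mxE scalerDl scalerA.
Qed.

HB.instance Definition _ a b Phi Psi := GRing.isLinear.Build C
  'M[C]_(a * b) 'M[C]_(a * b) _ _ (@tens_chan_is_linear a b Phi Psi).

Fact conjugate_is_linear D (G : 'M[C]_D) : linear (conjugate G).
Proof.
by move=> x A B; rewrite /conjugate linearP mulmxDl -scalemxAl.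
Qed.

HB.instance Definition _ D (G : 'M[C]_D) := GRing.isLinear.Build C
  'M[C]_D 'M[C]_D _ _ (conjugate_is_linear G).

Fact depol_is_linear D (p : R) : linear (@depol R D p).
Proof.
move=> x A B; rewrite /depol mxtraceD mxtraceZ.
by apply/matrixP => i j; rewrite !mxE; ring.
Qed.

HB.instance Definition _ D p := GRing.isLinear.Build C
  'M[C]_D 'M[C]_D _ _ (@depol_is_linear D p).

(** Traceless operators and multiples of the identity are the two eigenspaces through which
    depolarizing noise is handled; [depol1] is the other half. *)
Lemma depol_trace0 D p (A : 'M[C]_D) : \tr A = 0 -> depol p A = p%:C *: A.
Proof. by move=> A0; rewrite /depol A0 mulr0 mul0r scale0r addr0. Qed.

Lemma depol1 D p : (0 < D)%N -> depol p 1%:M = 1%:M :> 'M[C]_D.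
Proof.
move=> D0; rewrite /depol mxtrace1 mulfK ?pnatr_eq0 -?lt0n //.
by rewrite -scalerDl -rmorphD /= addrC subrK scale1r.
Qed.

Lemma conjugateM D (G H A : 'M[C]_D) :
  conjugate (G *m H) A = conjugate G (conjugate H A).
Proof. by rewrite /conjugate adjmxM !mulmxA. Qed.

Lemma conjugate_tens a b (G : 'M[C]_a) (H : 'M[C]_b) A B :
  conjugate (G *t H) (A *t B) = conjugate G A *t conjugate H B.
Proof. by rewrite /conjugate adjmx_tens !tensmx_mul. Qed.

Lemma mxtrace_conjugate D (G A : 'M[C]_D) :
  G \is unitarymx -> \tr (conjugate G A) = \tr A.
Proof.
move=> Gu; rewrite /conjugate mxtrace_mulC mulmxA.
by rewrite (mulmx1C (unitarymxP Gu)) mul1mx.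
Qed.

Lemma conjugate1 D (G : 'M[C]_D) :
  G \is unitarymx -> conjugate G 1%:M = 1%:M.
Proof. by move=> Gu; rewrite /conjugate mulmx1 (unitarymxP Gu). Qed.

End TensChan.

(** * Qubit tensors and Pauli strings *)

(** Induction on [n]: digit 0 fixes the remainder modulo 2, and the remaining digits are those of
    the quotient by 2. *)
Lemma binary_digits_inj n a b : (a < 2 ^ n)%N -> (b < 2 ^ n)%N ->
  (forall m, (m < n)%N -> (a %/ 2 ^ m) %% 2 = (b %/ 2 ^ m) %% 2)%N -> a = b.
Proof.
elim: n a b => [|n IH] a b; first by rewrite !ltnS !leqn0 => /eqP-> /eqP->.
rewrite expnS => a_lt b_lt eqab; rewrite (divn_eq a 2) (divn_eq b 2).
have := eqab 0 isT; rewrite expn0 !divn1 => ->; congr (_ * _ + _)%N.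
apply: IH; rewrite ?ltn_divLR // 1?mulnC // => m m_lt.
by rewrite -!divnMA -expnS eqab.
Qed.

Lemma ord2_ind (P : 'I_2 -> Prop) : P 0 -> P 1 -> forall i, P i.
Proof.
move=> P0 P1 [[|[|//]] i_lt].
  by rewrite (_ : Ordinal _ = 0) //; apply: val_inj.
by rewrite (_ : Ordinal _ = 1) //; apply: val_inj.
Qed.

Section QubitTensors.
Variables (R : realType) (n : nat).
Local Notation C := R[i].
Implicit Types (j : 'I_n) (M : 'I_n -> 'M[C]_2).

Lemma qbit_inj (i k : 'I_(2 ^ n)) : (forall j, qbit i j = qbit k j) -> i = k.
Proof.
move=> eqik; apply: val_inj.
apply: (@binary_digits_inj n); rewrite ?ltn_ord // => m m_lt.
have := congr1 val (eqik (rev_ord (Ordinal m_lt))).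
by rewrite /qbit rev_ordK.
Qed.

(** Digit extraction is a bijection from basis indices to bit functions, being injective between
    sets of equal size; distributivity then exchanges sum and product. *)
Lemma sum_qbits (F : 'I_n -> 'I_2 -> C) :
  \sum_i \prod_j F j (qbit i j) = \prod_j \sum_b F j b.
Proof.
pose bits (i : 'I_(2 ^ n)) := [ffun j => qbit i j].
have bits_bij : bijective bits.
  apply: inj_card_bij; last by rewrite card_ffun !card_ord.
  move=> i k /ffunP eqik; apply: qbit_inj => j.
  by have := eqik j; rewrite !ffunE.
rewrite bigA_distr_bigA (reindex bits) /=; last exact/onW_bij.
by apply: eq_bigr => i _; apply: eq_bigr => j _; rewrite ffunE.
Qed.

Lemma eq_tens_qubits M M' : M =1 M' -> tens_qubits M = tens_qubits M'.
Proof. by move=> eqM; congr tens_qubits; apply/funext. Qed.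

Lemma tens_qubitsM M M' :
  tens_qubits M *m tens_qubits M' = tens_qubits (fun j => M j *m M' j).
Proof.
apply/matrixP => i k; rewrite !mxE.
under eq_bigr => l _ do rewrite !mxE -big_split.
rewrite (sum_qbits (fun j b => M j (qbit i j) b * M' j b (qbit k j))).
by apply: eq_bigr => j _; rewrite mxE.
Qed.

Lemma adj_tens_qubits M :
  (tens_qubits M) ^t* = tens_qubits (fun j => (M j) ^t*).
Proof.
apply/matrixP => i k; rewrite !mxE rmorph_prod.
by apply: eq_bigr => j _; rewrite !mxE.
Qed.

Lemma tens_qubitsZ (s : 'I_n -> C) M :
  tens_qubits (fun j => s j *: M j) = (\prod_j s j) *: tens_qubits M.
Proof.
apply/matrixP => i k; rewrite !mxE -big_split.
by apply: eq_bigr => j _; rewrite mxE.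
Qed.

Lemma tens_qubits1 : tens_qubits (fun=> 1%:M) = 1%:M :> 'M[C]_(2 ^ n).
Proof.
apply/matrixP => i k; rewrite !mxE; case: eqP => [->|ik].
  by rewrite big1 // => j _; rewrite mxE eqxx.
have [j ijk] : exists j, qbit i j != qbit k j.
  apply/existsP; rewrite -negb_forall; apply/forallP => eqik.
  by apply: ik; apply: qbit_inj => j; apply/eqP.
by rewrite (bigD1 j) //= mxE (negPf ijk) mul0r.
Qed.

Lemma mxtrace_tens_qubits M : \tr (tens_qubits M) = \prod_j \tr (M j).
Proof.
rewrite /mxtrace -sum_qbits; apply: eq_bigr => i _; rewrite mxE.
by apply: eq_bigr.
Qed.

Lemma tens_qubits_sum (I : finType) (F : 'I_n -> I -> 'M[C]_2) :
  tens_qubits (fun j => \sum_b F j b) =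
  \sum_(f : {ffun 'I_n -> I}) tens_qubits (fun j => F j (f j)).
Proof.
apply/matrixP => i k; rewrite !mxE summxE.
under eq_bigr => j _ do rewrite summxE.
by rewrite bigA_distr_bigA; apply: eq_bigr => f _; rewrite mxE.
Qed.

Lemma mul_on_qubit_tens j G M : on_qubit j G *m tens_qubits M =
  tens_qubits (fun i => if i == j then G *m M j else M i).
Proof.
rewrite /on_qubit tens_qubitsM; apply: eq_tens_qubits => i.
by case: eqP => [->|_] //; rewrite mul1mx.
Qed.

Lemma mul_tens_on_qubit j G M : tens_qubits M *m on_qubit j G =
  tens_qubits (fun i => if i == j then M j *m G else M i).
Proof.
rewrite /on_qubit tens_qubitsM; apply: eq_tens_qubits => i.
by case: eqP => [->|_] //; rewrite mulmx1.
Qed.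

Lemma adj_on_qubit j (G : 'M[C]_2) : (on_qubit j G) ^t* = on_qubit j (G ^t*).
Proof.
rewrite /on_qubit adj_tens_qubits; apply: eq_tens_qubits => i.
by case: eqP => // _; rewrite adjmx1.
Qed.

Lemma on_qubitM j (G H : 'M[C]_2) :
  on_qubit j G *m on_qubit j H = on_qubit j (G *m H).
Proof.
rewrite mul_on_qubit_tens; apply: eq_tens_qubits => i.
by rewrite eqxx; case: eqP.
Qed.

Lemma on_qubit1 j : on_qubit j 1%:M = 1%:M :> 'M[C]_(2 ^ n).
Proof.
by rewrite -tens_qubits1; apply: eq_tens_qubits => i; case: ifP.
Qed.

Lemma tens_qubits_slotE j G M i k :
  tens_qubits (fun l => if l == j then G else M l) i k =
  G (qbit i j) (qbit k j) * \prod_(l | l != j) M l (qbit i l) (qbit k l).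
Proof.
rewrite mxE (bigD1 j) //= eqxx; congr (_ * _).
by apply: eq_bigr => l /negPf ->.
Qed.

Lemma tens_qubits_slotD j G H M :
  tens_qubits (fun i => if i == j then G + H else M i) =
  tens_qubits (fun i => if i == j then G else M i) +
  tens_qubits (fun i => if i == j then H else M i).
Proof.
by apply/matrixP => i k; rewrite [RHS]mxE !tens_qubits_slotE mxE mulrDl.
Qed.

Lemma tens_qubits_slotZ j (s : C) G M :
  tens_qubits (fun i => if i == j then s *: G else M i) =
  s *: tens_qubits (fun i => if i == j then G else M i).
Proof.
by apply/matrixP => i k; rewrite [RHS]mxE !tens_qubits_slotE mxE mulrA.
Qed.

(** Used to deduce commutation with a whole Pauli string from commutation with its one-qubit
    factors. *)
Lemma tens_qubits_on_qubits M :
  tens_qubits M = \big[mulmx/1%:M]_(j <- enum 'I_n) on_qubit j (M j).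
Proof.
have prodE s : uniq s -> \big[mulmx/1%:M]_(j <- s) on_qubit j (M j) =
    tens_qubits (fun i => if i \in s then M i else 1%:M).
  elim: s => [_|j s IH /= /andP[js /IH sE]].
    by rewrite big_nil -tens_qubits1.
  rewrite big_cons sE mul_on_qubit_tens; apply: eq_tens_qubits => i.
  by rewrite in_cons; case: eqP => [->|//]; rewrite (negPf js) mulmx1.
rewrite prodE ?enum_uniq //; apply: eq_tens_qubits => i.
by rewrite mem_enum.
Qed.

End QubitTensors.

Section OneQubit.
Variable R : realType.
Local Notation C := R[i].

(** The entries of X^l Z^k: [l] selects the antidiagonal and [k] negates the second column. With
    explicit entries the one-qubit identities become finite case checks. *)
Definition pauli1 (l k : bool) : 'M[C]_2 :=
  \matrix_(i, j) if (i != j) == l then (-1) ^+ (k && (j != 0)) else 0.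

Definition ketbra (b : bool) : 'M[C]_2 := if b then ketbra1 R else ketbra0 R.

Lemma pauli1E (l k : bool) : sigma_x R ^+ l *m sigma_z R ^+ k = pauli1 l k.
Proof.
apply/matrixP => i j; case: l; case: k; rewrite ?expr0 ?expr1 ?mulmx1 ?mul1mx;
  rewrite /sigma_x /sigma_z /ketbra0 /ketbra1;
  elim/ord2_ind: i; elim/ord2_ind: j;
  rewrite !(mxE, big_ord_recl, big_ord0) /= ?expr0 ?expr1; ring.
Qed.

Lemma pauli1_00 : pauli1 false false = 1%:M.
Proof. by rewrite -pauli1E !expr0 mulmx1. Qed.

Lemma adj_pauli1 l k :
  (pauli1 l k) ^t* = (-1) ^+ (l && k) *: pauli1 l k.
Proof.
apply/matrixP => i j; rewrite !mxE; case: l; case: k;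
  elim/ord2_ind: i; elim/ord2_ind: j;
  rewrite /= ?rmorph0 ?rmorphXn ?rmorphN1 ?expr0 ?expr1 ?rmorph1; ring.
Qed.

Lemma pauli1_unitary l k : pauli1 l k *m (pauli1 l k) ^t* = 1%:M.
Proof.
rewrite adj_pauli1.
apply/matrixP => i j; case: l; case: k;
  elim/ord2_ind: i; elim/ord2_ind: j;
  rewrite !(mxE, big_ord_recl, big_ord0) /= ?expr0 ?expr1; ring.
Qed.

Lemma mxtrace_adj_pauli1 l k l' k' :
  \tr ((pauli1 l k) ^t* *m pauli1 l' k') = 2 * ((l == l') && (k == k'))%:R.
Proof.
rewrite adj_pauli1.
rewrite /mxtrace; case: l; case: k; case: l'; case: k';
  rewrite !(mxE, big_ord_recl, big_ord0) /= ?expr0 ?expr1; ring.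
Qed.

Lemma pauli1_complete (i j i' j' : 'I_2) :
  \sum_l \sum_k ((pauli1 l k i j)^*)%R * pauli1 l k i' j' =
  2 * ((i == i') && (j == j'))%:R.
Proof.
rewrite !big_bool !mxE; elim/ord2_ind: i; elim/ord2_ind: j;
  elim/ord2_ind: i'; elim/ord2_ind: j';
  rewrite /= ?rmorph0 ?rmorphN ?expr0 ?expr1 ?rmorphN1 ?rmorph1; ring.
Qed.

Lemma adj_hadamard : (hadamard R) ^t* = hadamard R.
Proof.
rewrite /hadamard adjmxZ /sigma_x /sigma_z /ketbra0 /ketbra1.
rewrite adjmxD adjmxD adjmxB !adjmx_delta (addrC (delta_mx 1 0)).
by congr (_ *: _); apply: conj_Creal; rewrite complex_real.
Qed.

Lemma hadamard_sqr : hadamard R *m hadamard R = 1%:M.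
Proof.
have sqr2 : (Num.sqrt 2)^-1 * (Num.sqrt 2)^-1 = 2^-1 :> R.
  by rewrite -invfM -expr2 sqr_sqrtr.
rewrite /hadamard -scalemxAl -scalemxAr scalerA -rmorphM sqr2.
rewrite /sigma_x /sigma_z /ketbra0 /ketbra1 fmorphV rmorph_nat.
apply/matrixP => i j; elim/ord2_ind: i; elim/ord2_ind: j;
  rewrite !(mxE, big_ord_recl, big_ord0) /=; by field.
Qed.

Lemma hadamard_pauli1 l k : hadamard R *m pauli1 l k =
  (-1) ^+ (l && k) *: (pauli1 k l *m hadamard R).
Proof.
rewrite /hadamard -scalemxAl -scalemxAr !scalerA mulrC -scalerA.
congr (_ *: _); rewrite /sigma_x /sigma_z /ketbra0 /ketbra1.
apply/matrixP => i j; case: l; case: k;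
  elim/ord2_ind: i; elim/ord2_ind: j;
  rewrite !(mxE, big_ord_recl, big_ord0) /= ?expr0 ?expr1; ring.
Qed.

(** The free [k'] inserts Z^k' next to the projector, where it acts as a sign. In the CNOT
    computation [k'] is the Z exponent of the target, which propagates back to the control. *)
Lemma ketbra_pauli1 b l k k' : ketbra b *m pauli1 l k =
  (-1) ^+ (k' && (b (+) l)) *: (pauli1 l (k (+) k') *m ketbra (b (+) l)).
Proof.
rewrite /ketbra /ketbra0 /ketbra1.
apply/matrixP => i j; case: b; case: l; case: k; case: k';
  elim/ord2_ind: i; elim/ord2_ind: j;
  rewrite !(mxE, big_ord_recl, big_ord0) /= ?expr0 ?expr1; ring.
Qed.

Lemma sigma_x_pauli1 (b c l k : bool) : sigma_x R ^+ b *m pauli1 l k =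
  (-1) ^+ (k && (b (+) c)) *: (pauli1 (l (+) c) k *m sigma_x R ^+ (b (+) c)).
Proof.
have -> x : sigma_x R ^+ (x : bool) = pauli1 x false.
  by rewrite -pauli1E expr0 mulmx1.
apply/matrixP => i j; case: b; case: c; case: l; case: k;
  elim/ord2_ind: i; elim/ord2_ind: j;
  rewrite !(mxE, big_ord_recl, big_ord0) /= ?expr0 ?expr1; ring.
Qed.

(** The coefficients are the two-point Fourier transform of the diagonal. *)
Lemma diag_pauli1 (a b : C) : a *: ketbra0 R + b *: ketbra1 R =
  \sum_k ((a + (-1) ^+ (k : bool) * b) / 2) *: pauli1 false k.
Proof.
rewrite /ketbra0 /ketbra1 big_bool expr0 expr1 mul1r mulN1r.
apply/matrixP => i j; elim/ord2_ind: i; elim/ord2_ind: j;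
  rewrite !mxE /= ?expr0 ?expr1; by field.
Qed.

Lemma ketbra0E : ketbra0 R = \sum_k 2^-1 *: pauli1 false k.
Proof.
have := diag_pauli1 1 0; rewrite scale1r scale0r addr0 => ->.
by apply: eq_bigr => k _; rewrite mulr0 addr0 mul1r.
Qed.

Lemma readout0E p : readout0 p =
  \sum_k ((p 0 0 + (-1) ^+ (k : bool) * p 0 1) / 2)%:C *: pauli1 false k.
Proof.
rewrite /readout0 diag_pauli1; apply: eq_bigr => k _; congr (_ *: _).
by rewrite rmorphM fmorphV rmorph_nat rmorphD rmorphM rmorphXn rmorphN1.
Qed.

End OneQubit.

Lemma sum_pair (V : nmodType) (I J : finType) (F : I * J -> V) :
  \sum_a F a = \sum_i \sum_j F (i, j).
Proof. by rewrite pair_big; apply: eq_bigr => -[]. Qed.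

(** * Operator families with a completeness relation *)

Section CompleteFamily.
Variables (K : numClosedFieldType) (D : nat) (I : finType).
Variables (Q : I -> 'M[K]_D) (c : K).
Hypothesis Q_complete : forall i j k l,
  \sum_a ((Q a i j)^*)%R * Q a k l = c * ((i == k) && (j == l))%:R.

Lemma complete_expansion A :
  c *: A = \sum_a \tr ((Q a) ^t* *m A) *: Q a.
Proof.
apply/matrixP => k l; rewrite mxE summxE.
have trE a : (\tr ((Q a) ^t* *m A) *: Q a) k l =
    \sum_i \sum_j A j i * (((Q a j i)^*)%R * Q a k l).
  rewrite mxE /mxtrace mulr_suml; apply: eq_bigr => i _; rewrite !mxE mulr_suml.
  by apply: eq_bigr => j _; rewrite !mxE; ring.
under eq_bigr => a _ do rewrite trE.
rewrite exchange_big /= (bigD1 l) //= exchange_big /= (bigD1 k) //=.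
rewrite -mulr_sumr Q_complete !eqxx mulr1 (mulrC c).
rewrite big1 ?addr0 => [|j jk]; last first.
  by rewrite -mulr_sumr Q_complete (negPf jk) !mulr0.
rewrite big1 ?addr0 // => i il; rewrite exchange_big big1 // => j _.
by rewrite -mulr_sumr Q_complete (negPf il) andbF !mulr0.
Qed.

(** The twirl of [A] by the family is [c] times its trace times the identity, tested here against
    [B]: written out in entries, completeness contracts two of the four indices. *)
Lemma complete_twirl A B :
  \sum_a \tr ((Q a) ^t* *m A *m Q a *m B) = c * \tr A * \tr B.
Proof.
have trE a : \tr ((Q a) ^t* *m A *m Q a *m B) =
    \sum_i \sum_j \sum_k \sum_l A k l * B j i * (((Q a k i)^*)%R * Q a l j).
  rewrite /mxtrace; apply: eq_bigr => i _; rewrite !mxE; apply: eq_bigr => j _.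
  rewrite !mxE mulr_suml.
  under eq_bigr => l _ do rewrite !mxE !mulr_suml.
  rewrite exchange_big /=; apply: eq_bigr => k _; apply: eq_bigr => l _.
  by rewrite !mxE; ring.
under eq_bigr => a _ do rewrite trE.
have sum_diag (F : 'I_D -> K) i : \sum_j F j * (i == j)%:R = F i.
  rewrite (bigD1 i) //= eqxx mulr1 big1 ?addr0 // => j ji.
  by rewrite eq_sym (negPf ji) mulr0.
transitivity (\sum_i \sum_j \sum_k \sum_l
    c * (A k l * (k == l)%:R) * (B j i * (i == j)%:R)).
  rewrite exchange_big; apply: eq_bigr => i _.
  rewrite exchange_big; apply: eq_bigr => j _.
  rewrite exchange_big; apply: eq_bigr => k _.
  rewrite exchange_big; apply: eq_bigr => l _.
  by rewrite -mulr_sumr Q_complete -mulnb natrM; ring.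
rewrite [in RHS]/mxtrace mulr_sumr; apply: eq_bigr => i _.
under eq_bigr => j _ do [under eq_bigr => k _ do
  [rewrite -mulr_suml -mulr_sumr (sum_diag (A k))]; rewrite -mulr_suml mulrA].
by rewrite (sum_diag (fun j => _ * B j i)) -mulr_sumr.
Qed.

End CompleteFamily.

Section Paulis.
Variables (R : realType) (n : nat).
Local Notation C := R[i].
Local Notation d := (2 ^ n)%N.
Local Notation P := (@pauli R n).
Local Notation PAB := (@pauliAB R n).
Implicit Types (a b : pauli_label n).

Lemma pauliE a :
  P a = tens_qubits (fun j => pauli1 R (a.1 j) (a.2 j)).
Proof. by apply: eq_tens_qubits => j; rewrite pauli1E. Qed.

Lemma pauli_label0 : P (label0 n) = 1%:M.
Proof.
rewrite pauliE -tens_qubits1; apply: eq_tens_qubits => j.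
by rewrite !ffunE pauli1_00.
Qed.

Lemma pauliAB_label0 : PAB (label0 n, label0 n) = 1%:M.
Proof. by rewrite /pauliAB pauli_label0 tens1mx1. Qed.

Lemma adj_pauli a :
  (P a) ^t* = (\prod_j (-1) ^+ (a.1 j && a.2 j)) *: P a.
Proof.
rewrite pauliE adj_tens_qubits -tens_qubitsZ; apply: eq_tens_qubits => j.
exact: adj_pauli1.
Qed.

(** A string is Hermitian up to a sign, which occurs twice in its tensor square. *)
Lemma adj_pauliAB_diag a : (PAB (a, a)) ^t* = PAB (a, a).
Proof.
rewrite /pauliAB adjmx_tens adj_pauli tensmxZl tensmxZr scalerA -big_split /=.
by rewrite big1 ?scale1r // => j _; rewrite -signr_addb addbb.
Qed.

Lemma pauli_unitary a : P a \is unitarymx.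
Proof.
apply/unitarymxP; rewrite pauliE adj_tens_qubits tens_qubitsM -tens_qubits1.
by apply: eq_tens_qubits => j; rewrite pauli1_unitary.
Qed.

Lemma mxtrace_adj_pauli a b : \tr ((P a) ^t* *m P b) = d%:R * (a == b)%:R.
Proof.
rewrite !pauliE adj_tens_qubits tens_qubitsM mxtrace_tens_qubits.
under eq_bigr => j _ do rewrite mxtrace_adj_pauli1.
rewrite big_split /= prodr_const card_ord natrX; congr (_ * _).
case: eqP => [->|ab]; first by rewrite big1 // => j _; rewrite !eqxx.
have [j abj] : exists j, ~~ ((a.1 j == b.1 j) && (a.2 j == b.2 j)).
  apply/existsP; rewrite -negb_forall; apply/forallP => eqab; apply: ab.
  case: a b eqab => [a1 a2] [b1 b2] eqab; congr (_, _); apply/ffunP => j;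
    by have /andP[/eqP ? /eqP ?] := eqab j.
by rewrite (bigD1 j) //= (negPf abj) mul0r.
Qed.

Lemma mxtrace_pauli a : \tr (P a) = d%:R * (a == label0 n)%:R.
Proof.
by rewrite eq_sym -mxtrace_adj_pauli pauli_label0 adjmx1 mul1mx.
Qed.

Lemma mxtrace_adj_pauliAB (a b : pauli_label n * pauli_label n) :
  \tr ((PAB a) ^t* *m PAB b) = d%:R ^+ 2 * (a == b)%:R.
Proof.
rewrite /pauliAB adjmx_tens tensmx_mul mxtrace_tens !mxtrace_adj_pauli.
by case: a b => [a a'] [b b']; rewrite xpair_eqE -mulnb natrM /=; ring.
Qed.

Lemma mxtrace_pauliAB (ab : pauli_label n * pauli_label n) :
  \tr (PAB ab) = d%:R ^+ 2 * (ab == (label0 n, label0 n))%:R.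
Proof.
by rewrite eq_sym -mxtrace_adj_pauliAB pauliAB_label0 adjmx1 mul1mx.
Qed.

Lemma pauli_complete i j k l :
  \sum_a ((P a i j)^*)%R * P a k l = d%:R * ((i == k) && (j == l))%:R.
Proof.
rewrite sum_pair.
have PE x z : ((P (x, z) i j)^*)%R * P (x, z) k l = \prod_(q < n)
    (((pauli1 R (x q) (z q) (qbit i q) (qbit j q))^*)%R *
     pauli1 R (x q) (z q) (qbit k q) (qbit l q)).
  by rewrite pauliE !mxE rmorph_prod -big_split.
(* The sum over labels is distributed over the qubits, first in the Z exponents and then in the X
   exponents, leaving one-qubit completeness in each factor. *)
under eq_bigr => x _ do [under eq_bigr => z _ do rewrite PE;
  rewrite -(bigA_distr_bigA (fun q zq =>
    ((pauli1 R (x q) zq (qbit i q) (qbit j q))^*)%R *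
    pauli1 R (x q) zq (qbit k q) (qbit l q)))].
rewrite -(bigA_distr_bigA (fun q xq => \sum_zq
    ((pauli1 R xq zq (qbit i q) (qbit j q))^*)%R *
    pauli1 R xq zq (qbit k q) (qbit l q))) /=.
under eq_bigr => q _ do rewrite pauli1_complete.
rewrite big_split /= prodr_const card_ord natrX; congr (_ * _).
case: andP => [[/eqP-> /eqP->]|ijkl].
  by rewrite big1 // => q _; rewrite !eqxx.
have [q ijklq] : exists q,
    ~~ ((qbit i q == qbit k q) && (qbit j q == qbit l q)).
  apply/existsP; rewrite -negb_forall; apply/forallP => eqq; apply: ijkl.
  by split; apply/eqP; apply: qbit_inj => q; have /andP[/eqP ? /eqP ?] := eqq q.
by rewrite (bigD1 q) //= (negPf ijklq) mul0r.
Qed.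

Lemma pauliAB_complete i j k l :
  \sum_a ((PAB a i j)^*)%R * PAB a k l =
  d%:R ^+ 2 * ((i == k) && (j == l))%:R.
Proof.
case: (mxtens_indexP i) (mxtens_indexP j) => i1 i2 [j1 j2].
case: (mxtens_indexP k) (mxtens_indexP l) => k1 k2 [l1 l2].
rewrite sum_pair.
rewrite !(can_eq (@mxtens_indexK d d)) !xpair_eqE.
transitivity ((\sum_a ((P a i1 j1)^*)%R * P a k1 l1) *
              (\sum_a ((P a i2 j2)^*)%R * P a k2 l2)).
  rewrite big_distrlr; apply: eq_bigr => a _; apply: eq_bigr => b _ /=.
  by rewrite /pauliAB !tensmxE rmorphM mulrACA.
by rewrite !pauli_complete andbACA -[in RHS]mulnb natrM; ring.
Qed.

End Paulis.

(** * Clifford gates and the entangling circuit *)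

Section Clifford.
Variables (R : realType) (n : nat).
Local Notation C := R[i].
Local Notation d := (2 ^ n)%N.
Local Notation P := (@pauli R n).
Local Notation PAB := (@pauliAB R n).
Implicit Types (a b : pauli_label n) (ab : pauli_label n * pauli_label n).
Implicit Types (j : 'I_n) (s : seq 'I_n) (l k : {ffun 'I_n -> bool}).
Implicit Types (gs : seq 'M[C]_(2 ^ n * 2 ^ n)).

Definition had_label j a : pauli_label n :=
  ([ffun i => if i == j then a.2 i else a.1 i],
   [ffun i => if i == j then a.1 i else a.2 i]).

(** X exponents propagate from control to target, Z exponents from target to control. *)
Definition cnot_label j ab : pauli_label n * pauli_label n :=
  ((ab.1.1, [ffun i => ab.1.2 i (+) ((i == j) && ab.2.2 i)]),
   ([ffun i => ab.2.1 i (+) ((i == j) && ab.1.1 i)], ab.2.2)).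

(** Reduces conjugation by a gate to a commutation rule, which can be checked qubit by qubit. *)
Lemma conjugate_intertwine D (G A B : 'M[C]_D) (s : C) :
  G \is unitarymx -> G *m A = s *: (B *m G) -> conjugate G A = s *: B.
Proof.
by move=> Gu GA; rewrite /conjugate GA -scalemxAl mulmxtVK.
Qed.

Lemma adj_gateH j : (gateH R j) ^t* = gateH R j.
Proof.
by rewrite /gateH adjmx_tens adj_on_qubit adj_hadamard adjmx1.
Qed.

Lemma gateH_unitary j : gateH R j \is unitarymx.
Proof.
apply/unitarymxP; rewrite adj_gateH /gateH tensmx_mul on_qubitM.
by rewrite hadamard_sqr on_qubit1 mulmx1 tens1mx1.
Qed.

Lemma conjugate_gateH j ab : conjugate (gateH R j) (PAB ab) =
  (-1) ^+ (ab.1.1 j && ab.1.2 j) *: PAB (had_label j ab.1, ab.2).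
Proof.
apply: conjugate_intertwine; first exact: gateH_unitary.
rewrite /gateH /pauliAB !tensmx_mul mul1mx mulmx1 -tensmxZl; congr (_ *t _).
rewrite !pauliE mul_on_qubit_tens mul_tens_on_qubit -tens_qubits_slotZ.
apply: eq_tens_qubits => i; rewrite !ffunE eqxx hadamard_pauli1.
by case: eqP => //.
Qed.

Lemma gateCNOTE j : gateCNOT R j =
  \sum_b on_qubit j (ketbra R b) *t on_qubit j (sigma_x R ^+ (b : bool)).
Proof.
by rewrite big_bool /= expr0 expr1 on_qubit1 addrC.
Qed.

Lemma adj_gateCNOT j : (gateCNOT R j) ^t* = gateCNOT R j.
Proof.
rewrite /gateCNOT adjmxD !adjmx_tens !adj_on_qubit adjmx1 /ketbra0 /ketbra1.
by rewrite !adjmx_delta /sigma_x adjmxD !adjmx_delta (addrC (delta_mx 1 0)).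
Qed.

Lemma gateCNOT_unitary j : gateCNOT R j \is unitarymx.
Proof.
apply/unitarymxP; rewrite adj_gateCNOT /gateCNOT.
have k01 : ketbra0 R *m ketbra1 R = 0 by rewrite mul_delta_mx_0.
have k10 : ketbra1 R *m ketbra0 R = 0 by rewrite mul_delta_mx_0.
have k00 : ketbra0 R *m ketbra0 R = ketbra0 R by rewrite mul_delta_mx.
have k11 : ketbra1 R *m ketbra1 R = ketbra1 R by rewrite mul_delta_mx.
have xx : sigma_x R *m sigma_x R = 1%:M.
  rewrite -(pauli1_unitary R true false) adj_pauli1 expr0 scale1r.
  by rewrite -pauli1E expr0 expr1 mulmx1.
rewrite mulmxDl !mulmxDr !tensmx_mul !on_qubitM mulmx1 mul1mx.
rewrite k00 k01 k10 k11 xx on_qubit1.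
have on0 : on_qubit j (0 : 'M[C]_2) = 0.
  by rewrite /on_qubit -(scale0r (1%:M : 'M[C]_2)) tens_qubits_slotZ scale0r.
rewrite on0 !tens0mx addr0 add0r -tensmxDl /on_qubit -tens_qubits_slotD.
have -> : ketbra0 R + ketbra1 R = 1%:M.
  rewrite /ketbra0 /ketbra1; apply/matrixP => i k.
  by elim/ord2_ind: i; elim/ord2_ind: k; rewrite !mxE /= ?addr0 ?add0r.
by rewrite -/(on_qubit _ _) on_qubit1 tens1mx1.
Qed.

Lemma conjugate_gateCNOT j ab :
  conjugate (gateCNOT R j) (PAB ab) = PAB (cnot_label j ab).
Proof.
rewrite -[RHS]scale1r; apply: conjugate_intertwine.
  exact: gateCNOT_unitary.
case: ab => a b; rewrite scale1r gateCNOTE mulmx_suml mulmx_sumr.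
(* The string flips the control bit by [a.1 j], so control branches correspond only after this
   shift. *)
rewrite [RHS](reindex_inj (@addIb (a.1 j))) /=; apply: eq_bigr => x _.
rewrite /pauliAB /= !tensmx_mul !pauliE.
rewrite !mul_on_qubit_tens !mul_tens_on_qubit /=.
(* These parameters make control and target carry the same sign, so the two signs cancel. *)
rewrite (ketbra_pauli1 _ _ _ _ (b.2 j)) (sigma_x_pauli1 _ _ (a.1 j)).
rewrite !tens_qubits_slotZ tensmxZl tensmxZr scalerA -signr_addb addbb scale1r.
congr (_ *t _); apply: eq_tens_qubits => i; rewrite !ffunE eqxx;
  by case: (i =P j) => //; rewrite addbF.
Qed.

Definition clifford G := forall ab, exists (s : C) ab',
  conjugate G (PAB ab) = s *: PAB ab'.

Lemma clifford_gateH j : clifford (gateH R j).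
Proof. by move=> ab; do 2!eexists; apply: conjugate_gateH. Qed.

Lemma clifford_gateCNOT j : clifford (gateCNOT R j).
Proof.
by move=> ab; exists 1; eexists; rewrite scale1r; apply: conjugate_gateCNOT.
Qed.

Fact run_is_linear gs : linear (run gs).
Proof.
elim: gs => [|G gs IH] x A B //=; rewrite /run /= linearP; exact: IH.
Qed.

HB.instance Definition _ gs := GRing.isLinear.Build C
  'M[C]_(2 ^ n * 2 ^ n) 'M[C]_(2 ^ n * 2 ^ n) _ _ (run_is_linear gs).

Lemma run_cons G gs A : run (G :: gs) A = run gs (conjugate G A).
Proof. by []. Qed.

Lemma run_cat gs gs' A : run (gs ++ gs') A = run gs' (run gs A).
Proof. exact: foldl_cat. Qed.

(** The sign of [conjugate_gateH] needs both exponents at the qubit to be 1; vanishing X exponents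
    on the qubits still to be processed keep it trivial. *)
Lemma run_gateH s l k b : uniq s -> (forall i, i \in s -> l i = false) ->
  run [seq gateH R i | i <- s] (PAB ((l, k), b)) =
  PAB (([ffun i => if i \in s then k i else l i],
        [ffun i => if i \in s then false else k i]), b).
Proof.
elim: s l k => [|j s IH] l k.
  by move=> _ _; congr (PAB (_, _, _)); apply/ffunP => i; rewrite ffunE.
rewrite cons_uniq map_cons => /andP[js s_uniq] l0.
rewrite run_cons conjugate_gateH [X in X && _]l0 ?mem_head // scale1r.
rewrite IH // => [|i si]; last first.
  rewrite ffunE ifN ?l0 ?in_cons ?si ?orbT //.
  by apply: contraNneq js => <-.
congr (PAB (_, _, _)); apply/ffunP => i; rewrite !ffunE in_cons;
  case: eqP => [->|] //=; rewrite (negPf js) //.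
by rewrite l0 ?mem_head.
Qed.

Lemma run_gateCNOT s a b : uniq s ->
  run [seq gateCNOT R i | i <- s] (PAB (a, b)) =
  PAB ((a.1, [ffun i => a.2 i (+) ((i \in s) && b.2 i)]),
       ([ffun i => b.1 i (+) ((i \in s) && a.1 i)], b.2)).
Proof.
elim: s a b => [|j s IH] [l k] [l' k'].
  move=> _; congr (PAB (_, _, (_, _))); apply/ffunP => i;
    by rewrite ffunE addbF.
rewrite cons_uniq map_cons => /andP[js s_uniq].
rewrite run_cons conjugate_gateCNOT IH //.
congr (PAB (_, _, (_, _))); apply/ffunP => i; rewrite !ffunE in_cons;
  by case: eqP => [->|] //=; rewrite ?(negPf js) ?addbF.
Qed.

Definition entangler (s : seq 'I_n) : seq 'M[C]_(2 ^ n * 2 ^ n) :=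
  [seq gateH R i | i <- s] ++ [seq gateCNOT R i | i <- s].

Definition zlabel (k : {ffun 'I_n -> bool}) : pauli_label n :=
  ([ffun=> false], k).

(** The Hadamards turn Z^k on A into X^k; the CNOTs copy it to B and carry Z^k' back to A. With [s]
    a list of qubits, the same statement serves the full circuit and the one-qubit test, provided
    the exponents vanish where no gate acts. *)
Lemma run_entangler s k k' : uniq s ->
  (forall i, k i -> i \in s) -> (forall i, k' i -> i \in s) ->
  run (entangler s) (PAB (zlabel k, zlabel k')) = PAB ((k, k'), (k, k')).
Proof.
move=> s_uniq ks ks'; rewrite run_cat run_gateH // => [|i _]; last first.
  by rewrite ffunE.
rewrite run_gateCNOT //; congr (PAB (_, _, (_, _))); apply/ffunP => i;
  rewrite !ffunE //=.
- by case: ifPn => // /(contraNF (ks i)).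
- by case: ifPn => //= /[dup] /(contraNF (ks i)) -> /(contraNF (ks' i)) ->.
- by case: ifPn => //= /(contraNF (ks i)).
Qed.

(** Passage to the Heisenberg picture: by cyclicity of the trace each inverse gate moves onto the
    observable. *)
Lemma mxtrace_mul_run_adj gs A B :
  \tr (A *m run [seq G ^t* | G <- rev gs] B) = \tr (run gs A *m B).
Proof.
elim: gs A => [|G gs IH] A //.
rewrite rev_cons map_rcons -cats1 run_cat !run_cons -IH.
rewrite [run [::] _]/= /conjugate trmxCK !mulmxA mxtrace_mulC.
by rewrite !mulmxA.
Qed.

Lemma tens_qubits_zstrings (c : 'I_n -> bool -> C) M :
  (forall i, M i = \sum_b c i b *: pauli1 R false b) ->
  tens_qubits M =
  \sum_(k : {ffun 'I_n -> bool}) (\prod_i c i (k i)) *: P (zlabel k).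
Proof.
move=> ME; rewrite (eq_tens_qubits ME) tens_qubits_sum; apply: eq_bigr => k _.
rewrite tens_qubitsZ pauliE; congr (_ *: _); apply: eq_tens_qubits => i.
by rewrite ffunE.
Qed.

End Clifford.

(** * Observables diagonal in the Bell basis *)

Section Observables.
Variables (R : realType) (n : nat).
Local Notation C := R[i].
Local Notation d := (2 ^ n)%N.
Local Notation P := (@pauli R n).
Local Notation PAB := (@pauliAB R n).
Implicit Types (a b : pauli_label n) (s : seq 'I_n).

(** [active] marks a measured qubit, whose readout has a positive Z component; an unmeasured qubit
    carries a positive multiple of the identity. *)
Definition z_diagonal (active : bool) (M : 'M[C]_2) : Prop :=
  exists c : bool -> C,
    [/\ M = \sum_b c b *: pauli1 R false b, 0 < c false
      & if active then 0 < c true else c true == 0].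

(** The Z coefficient is half of p00 - p01, so the assumption that readout favours the true value is
    its positivity. *)
Lemma z_diagonal_readout0 p : valid_readout p -> z_diagonal true (readout0 p).
Proof.
case=> p01 p1 p0_gt _.
exists (fun b : bool => ((p 0 0 + (-1) ^+ b * p 0 1) / 2)%:C).
have p00_gt0 : 0 < p 0 0.
  by apply: le_lt_trans p0_gt; have /andP[] := p01 0 1.
split; first exact: readout0E; rewrite (ltcR 0) divr_gt0 //.
  by rewrite expr0 mul1r ltr_wpDr //; have /andP[] := p01 0 1.
by rewrite expr1 mulN1r subr_gt0.
Qed.

Lemma z_diagonal_ketbra0 : z_diagonal true (ketbra0 R).
Proof.
exists (fun=> 2^-1); split; first exact: ketbra0E.
all: by rewrite invr_gt0.
Qed.

Lemma z_diagonal1 : z_diagonal false 1%:M.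
Proof.
exists (fun b : bool => (~~ b)%:R); split => //.
rewrite big_bool /= scale0r.
by rewrite add0r scale1r pauli1_00.
Qed.

Definition supported s a := forall i, i \notin s -> ~~ a.1 i && ~~ a.2 i.

(** The strings P_a (x) P_a commute and have the Bell basis as joint eigenbasis. Strict positivity
    is asked only for strings living on the measured qubits [s]. *)
Definition bell_diagonal s (O : 'M[C]_(d * d)) : Prop :=
  exists o : pauli_label n -> C,
    [/\ forall a, 0 <= o a, forall a, supported s a -> 0 < o a
      & O = \sum_a o a *: PAB (a, a)].

Lemma z_diagonal_tens s (MA MB : 'I_n -> 'M[C]_2) : uniq s ->
  (forall i, z_diagonal (i \in s) (MA i)) ->
  (forall i, z_diagonal (i \in s) (MB i)) ->
  bell_diagonal s (run (entangler R s) (tens_qubits MA *t tens_qubits MB)).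
Proof.
move=> s_uniq /fin_all_exists[cA cAP] /fin_all_exists[cB cBP].
have MAE i : MA i = \sum_b cA i b *: pauli1 R false b by case: (cAP i).
have MBE i : MB i = \sum_b cB i b *: pauli1 R false b by case: (cBP i).
(* By [run_entangler], Z exponents read on A become X exponents of the label, and those read on B
   become its Z exponents. *)
pose o (a : pauli_label n) := (\prod_i cA i (a.1 i)) * \prod_i cB i (a.2 i).
have ge0 (c : 'I_n -> bool -> C) i (b : bool) : 0 < c i false ->
    (if i \in s then 0 < c i true else c i true == 0) -> 0 <= c i b.
  by case: b => [_|/ltW]; [case: ifP => _ => [/ltW|/eqP->] |].
exists o; split.
- move=> a; apply: mulr_ge0; apply: prodr_ge0 => i _.
    by case: (cAP i) => _; apply: ge0.
  by case: (cBP i) => _; apply: ge0.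
- move=> a a_supp.
  have gt0 (c : 'I_n -> bool -> C) i (b : bool) : 0 < c i false ->
      (if i \in s then 0 < c i true else c i true == 0) ->
      (i \notin s -> ~~ b) -> 0 < c i b.
    by case: b => //; case: ifP => // _ _ _ /(_ isT).
  apply: mulr_gt0; apply: prodr_gt0 => i _.
    by case: (cAP i) => _ /gt0 /[apply]; apply => /a_supp /andP[].
  by case: (cBP i) => _ /gt0 /[apply]; apply => /a_supp /andP[].
rewrite (tens_qubits_zstrings MAE) (tens_qubits_zstrings MBE).
rewrite sum_pair tensmx_suml linear_sum; apply: eq_bigr => k _.
rewrite tensmx_sumr linear_sum; apply: eq_bigr => k' _.
rewrite tensmxZl tensmxZr scalerA linearZ /=.
(* A Z on an unmeasured qubit has coefficient 0, so every surviving string meets the support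
   conditions of [run_entangler]. *)
have supp0 (c : 'I_n -> bool -> C) (l : {ffun 'I_n -> bool}) :
    (forall i, if i \in s then 0 < c i true else c i true == 0) ->
    \prod_i c i (l i) = 0 \/ forall i, l i -> i \in s.
  move=> c0; have [i /andP[li si]|ls] := pickP [pred i | l i & i \notin s].
    left; rewrite (bigD1 i) //= li; have := c0 i.
    by rewrite (negPf si) => /eqP->; rewrite mul0r.
  by right => i li; have := ls i; rewrite /= li => /negbFE.
have [|oA0|ks] := supp0 cA k.
- by move=> i; case: (cAP i).
- by rewrite /o /= oA0 !mul0r !scale0r.
have [|oB0|ks'] := supp0 cB k'.
- by move=> i; case: (cBP i).
- by rewrite /o /= oB0 !mulr0 !scale0r.
by rewrite (_ : P _ *t P _ = PAB (zlabel k, zlabel k')) // run_entangler.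
Qed.

Lemma bell_diagonal_pairing s O : bell_diagonal s O ->
  exists o : pauli_label n -> C,
    [/\ forall a, 0 <= o a, forall a, supported s a -> 0 < o a
      & forall A, \tr (O *m A) = \sum_a o a * \tr ((PAB (a, a)) ^t* *m A)].
Proof.
case=> o [o_ge0 o_gt0 ->]; exists o; split => // A.
rewrite mulmx_suml raddf_sum /=; apply: eq_bigr => a _.
by rewrite -scalemxAl mxtraceZ adj_pauliAB_diag.
Qed.

Lemma bell_diagonal_on_qubit j (G H : 'M[C]_2) :
  z_diagonal true G -> z_diagonal true H ->
  bell_diagonal [:: j]
    (run (entangler R [:: j]) (on_qubit j G *t on_qubit j H)).
Proof.
move=> GP HP; apply: z_diagonal_tens => // i; rewrite inE; case: ifP => // _;
  exact: z_diagonal1.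
Qed.

Lemma zero_stateE :
  zero_state R n = d%:R ^- 2 *: \sum_k \sum_k' PAB (zlabel k, zlabel k').
Proof.
rewrite /zero_state (tens_qubits_zstrings (fun=> ketbra0E R)).
rewrite tensmx_suml scaler_sumr; apply: eq_bigr => k _.
rewrite tensmx_sumr scaler_sumr; apply: eq_bigr => k' _.
rewrite tensmxZl tensmxZr scalerA prodr_const card_ord /pauliAB.
by rewrite exprVn natrX expr2 invfM.
Qed.

End Observables.

(** * Noisy circuits *)

Section Noise.
Variables (R : realType) (n : nat) (inf : Prop).
Local Notation C := R[i].
Local Notation d := (2 ^ n)%N.
Local Notation P := (@pauli R n).
Local Notation PAB := (@pauliAB R n).
Implicit Types (a b : pauli_label n) (ab : pauli_label n * pauli_label n).
Implicit Types (g : gate_noise R n) (X : 'M[C]_(2 ^ n)).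

(** The proposition [inf] later becomes [informative N]: one pass through the circuit then gives
    nonnegative factors for all valid noise and positive ones for informative noise. *)
Definition gain (q : C) : Prop := 0 <= q /\ (inf -> 0 < q).

Lemma gainM q r : gain q -> gain r -> gain (q * r).
Proof.
move=> [q0 q1] [r0 r1]; split; first exact: mulr_ge0.
by move=> i; rewrite mulr_gt0 ?q1 ?r1.
Qed.

Lemma gain_gt0 q : 0 < q -> gain q.
Proof. by move=> q0; split=> [|//]; apply: ltW. Qed.

Definition scales D (Phi : 'M[C]_D -> 'M[C]_D) (A B : 'M[C]_D) : Prop :=
  exists q, gain q /\ Phi A = q *: B.

Lemma pauli_noise_scales D (I : finType) (e : I) (Q : I -> 'M[C]_D)
    (Phi : {linear 'M[C]_D -> 'M[C]_D}) :
  pauli_noise e Q Phi -> (inf -> kills_no_pauli Q Phi) ->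
  forall i, scales Phi (Q i) (Q i).
Proof.
move=> [_ [c [_ c_ge0 cE]]] kills i; exists (c i)%:C; split; last exact: cE.
split=> [|/kills/(_ i)]; first by rewrite lecR.
rewrite cE (ltcR 0) lt_neqAle c_ge0 andbT => ci.
by apply/eqP => c0; apply: ci; rewrite -c0 scale0r.
Qed.

Lemma depol_scales p ab : valid_depol p -> (inf -> 0 < p) ->
  scales (depol p) (PAB ab) (PAB ab).
Proof.
move=> /andP[p0 _] p1; have [->|ab0] := eqVneq ab (label0 n, label0 n).
  exists 1; split; first exact: gain_gt0.
  by rewrite pauliAB_label0 depol1 ?scale1r // muln_gt0 expn_gt0.
exists p%:C; split; first by split=> [|/p1]; rewrite ?lecR ?ltcR.
rewrite depol_trace0 // -[PAB ab]mul1mx -(adjmx1 _ (d * d)) -pauliAB_label0.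
by rewrite mxtrace_adj_pauliAB eq_sym (negPf ab0) mulr0.
Qed.

Fact noisy_gate_is_linear (Gg : 'M[C]_(2 ^ n * 2 ^ n) * gate_noise R n) :
  linear (noisy_gate Gg).
Proof.
move=> x A B; rewrite /noisy_gate [pre _ _]linearP [conjugate _ _]linearP.
by rewrite [post _ _]linearP [LHS]linearP.
Qed.

HB.instance Definition _ Gg := GRing.isLinear.Build C
  'M[C]_(2 ^ n * 2 ^ n) 'M[C]_(2 ^ n * 2 ^ n) _ _ (noisy_gate_is_linear Gg).

Fact noisy_run_is_linear (gs : seq ('M[C]_(2 ^ n * 2 ^ n) * gate_noise R n)) :
  linear (noisy_run gs).
Proof.
by elim: gs => [|Gg gs IH] x A B //=; rewrite /noisy_run /= linearP; exact: IH.
Qed.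

HB.instance Definition _ gs := GRing.isLinear.Build C
  'M[C]_(2 ^ n * 2 ^ n) 'M[C]_(2 ^ n * 2 ^ n) _ _ (noisy_run_is_linear gs).

Definition good_gate (Gg : 'M[C]_(2 ^ n * 2 ^ n) * gate_noise R n) : Prop :=
  [/\ clifford Gg.1, valid_gate_noise Gg.2
    & inf -> informative_gate_noise Gg.2].

(** The noise after the gate meets the image of the string, which for a Clifford gate is again a
    string up to a scalar. That scalar stays in the noiseless image, so the extracted factor remains
    nonnegative. *)
Lemma noisy_gate_scales Gg ab : good_gate Gg ->
  scales (noisy_gate Gg) (PAB ab) (conjugate Gg.1 (PAB ab)).
Proof.
case: Gg => G g [/= Gcl [g1 g2 g3] ginf]; have [s [ab' GE]] := Gcl ab.
have [q [q_gain preE]] := pauli_noise_scales g1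
  (fun i => let: And3 k _ _ := ginf i in k) ab.
have [r [r_gain postE]] := pauli_noise_scales g2
  (fun i => let: And3 _ k _ := ginf i in k) ab'.
have [t [t_gain depE]] := depol_scales ab' g3
  (fun i => let: And3 _ _ k := ginf i in k).
exists (q * r * t); split; first by do 2?apply: gainM.
rewrite /noisy_gate /= preE [conjugate _ _]linearZ /= GE.
rewrite [post _ _]linearZ /= [post _ (s *: _)]linearZ /= postE.
rewrite [depol _ _]linearZ /= [depol _ (s *: _)]linearZ /=.
rewrite [depol _ (r *: _)]linearZ /= depE.
by rewrite !scalerA; congr (_ *: _); ring.
Qed.

Lemma noisy_run_scales gs ab : List.Forall good_gate gs ->
  scales (noisy_run gs) (PAB ab) (run [seq Gg.1 | Gg <- gs] (PAB ab)).
Proof.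
elim: gs ab => [|Gg gs IH] ab => [_|/List.Forall_cons_iff[Ggood gsgood]].
  by exists 1; split; [apply: gain_gt0 | rewrite scale1r].
have [q [q_gain GE]] := noisy_gate_scales ab Ggood.
have [s [ab' GabE]] : exists s ab', conjugate Gg.1 (PAB ab) = s *: PAB ab'.
  by case: Ggood => /(_ ab).
have [r [r_gain rE]] := IH ab' gsgood.
exists (q * r); split; first exact: gainM.
rewrite map_cons run_cons /noisy_run /= GE GabE -/(noisy_run _ _).
by rewrite !linearZ /= rE !scalerA; congr (_ *: _); ring.
Qed.

Lemma Forall_map (I T : Type) (Q : T -> Prop) (f : I -> T) (s : seq I) :
  (forall i, Q (f i)) -> List.Forall Q [seq f i | i <- s].
Proof. by move=> Qf; elim: s => [|i s IH] //=; constructor. Qed.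

(** A map diagonal in the orthogonal Pauli basis scales Pauli coefficients of arbitrary operators by
    the same factors. *)
Lemma mxtrace_adj_pauli_scales (Phi : {linear 'M[C]_(d * d) -> 'M[C]_(d * d)}) :
  (forall ab, scales Phi (PAB ab) (PAB ab)) ->
  forall ab, exists q, gain q /\ forall A,
    \tr ((PAB ab) ^t* *m Phi A) = q * \tr ((PAB ab) ^t* *m A).
Proof.
move=> /fin_all_exists[q qP] ab; exists (q ab); split; first by case: (qP ab).
have d0 : d%:R ^+ 2 != 0 :> C by rewrite expf_neq0 ?pnatr_eq0 ?expn_eq0.
(* After multiplication by d^2, [A] can be replaced by its Pauli expansion without division. *)
move=> A; apply: (mulfI d0).
transitivity (\tr ((PAB ab) ^t* *m Phi (d%:R ^+ 2 *: A))).
  by rewrite [Phi (_ *: A)]linearZ -scalemxAr mxtraceZ.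
rewrite (complete_expansion (@pauliAB_complete R n) A) linear_sum mulmx_sumr.
rewrite raddf_sum (bigD1 ab) //= big1 ?addr0 => [|ab' ab'_neq].
  rewrite [Phi _]linearZ /=; case: (qP ab) => _ ->; rewrite -!scalemxAr.
  rewrite !mxtraceZ mxtrace_adj_pauliAB eqxx mulr1.
  by rewrite mulrCA [RHS]mulrCA (mulrC _ (d%:R ^+ 2)).
rewrite [Phi _]linearZ /=; case: (qP ab') => _ ->; rewrite -!scalemxAr.
by rewrite !mxtraceZ mxtrace_adj_pauliAB eq_sym (negPf ab'_neq) !mulr0.
Qed.

(** On each string of the Pauli expansion of [A] the noisy run is a scaled noiseless one, which
    moves onto the observable. Noise thus multiplies the ideal weight of P_a (x) P_a by the factor
    of that string. *)
Lemma noisy_measurement s (O : 'M[C]_(d * d)) gs :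
  bell_diagonal s (run (entangler R s) O) -> List.Forall good_gate gs ->
  [seq Gg.1 | Gg <- gs] = [seq G ^t* | G <- rev (entangler R s)] ->
  exists o : pauli_label n -> C,
    [/\ forall a, 0 <= o a, forall a, supported s a -> inf -> 0 < o a
      & forall A, \tr (O *m noisy_run gs A) =
          \sum_a o a * \tr ((PAB (a, a)) ^t* *m A)].
Proof.
move=> /bell_diagonal_pairing[o [o_ge0 o_gt0 oE]] gs_good gsE.
have /fin_all_exists[q qP] ab := noisy_run_scales ab gs_good.
exists (fun a => o a * q (a, a)); split.
- by move=> a; rewrite mulr_ge0 //; case: (qP (a, a)) => -[].
- move=> a /o_gt0 oa i; rewrite mulr_gt0 //.
  by case: (qP (a, a)) => -[_ qa _]; apply: qa.
have d0 : d%:R ^+ 2 != 0 :> C by rewrite expf_neq0 ?pnatr_eq0 ?expn_eq0.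
move=> A; apply: (mulfI d0).
transitivity (\tr (O *m noisy_run gs (d%:R ^+ 2 *: A))).
  by rewrite [noisy_run _ (_ *: A)]linearZ -scalemxAr mxtraceZ.
rewrite (complete_expansion (@pauliAB_complete R n) A) linear_sum mulmx_sumr.
rewrite raddf_sum /= mulr_sumr.
have termE ab : \tr (O *m noisy_run gs (\tr ((PAB ab) ^t* *m A) *: PAB ab)) =
    \tr ((PAB ab) ^t* *m A) * q ab *
    \sum_a o a * (d%:R ^+ 2 * ((a, a) == ab)%:R).
  rewrite [noisy_run _ _]linearZ /=; case: (qP ab) => _ ->.
  rewrite -!scalemxAr !mxtraceZ gsE mxtrace_mul_run_adj oE mulrA; congr (_ * _).
  by apply: eq_bigr => a _; rewrite mxtrace_adj_pauliAB.
under eq_bigr => ab _ do rewrite termE mulr_sumr.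
rewrite exchange_big; apply: eq_bigr => a _.
rewrite (bigD1 (a, a)) //= eqxx big1 ?addr0 => [|ab ab_neq].
  rewrite mulr1 mulrC mulrAC (mulrC _ (q _)).
  by rewrite [X in X * _]mulrA [RHS]mulrC.
by rewrite eq_sym (negPf ab_neq) !mulr0.
Qed.

End Noise.

(** * Costs as Pauli overlaps *)

Section Twirl.
Variables (R : realType) (n : nat).
Local Notation C := R[i].
Local Notation d := (2 ^ n)%N.
Local Notation P := (@pauli R n).
Implicit Types (a : pauli_label n) (V W : 'M[C]_(2 ^ n)).

Definition pauli_overlap a W : C := \tr ((P a) ^t* *m conjugate W (P a)).

(** The squared Hilbert-Schmidt distance between the string and its conjugate by [W]. *)
Definition pauli_defect a W : C :=
  \tr ((conjugate W (P a) - P a) *m (conjugate W (P a) - P a) ^t*).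

Lemma pauli_defect_ge0 a W : 0 <= pauli_defect a W.
Proof. exact: tr_adjmx_mul_ge0. Qed.

Lemma unitary_distance D (A B : 'M[C]_D) :
  A \is unitarymx -> B \is unitarymx ->
  \tr ((B - A) *m (B - A) ^t*) =
  D%:R *+ 2 - (\tr (A ^t* *m B) + ((\tr (A ^t* *m B))^*)%R).
Proof.
move=> /unitarymxP AA /unitarymxP BB.
rewrite adjmxB mulmxBl !mulmxBr AA BB !raddfB /= mxtrace1.
rewrite -tr_adjmx adjmxM trmxCK (mxtrace_mulC B) (mxtrace_mulC A).
by rewrite mulr2n; ring.
Qed.

Lemma conjugate_unitary D (G A : 'M[C]_D) :
  G \is unitarymx -> A \is unitarymx -> conjugate G A \is unitarymx.
Proof. exact: conj_unitary. Qed.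

Lemma pauli_defectE a W : W \is unitarymx ->
  pauli_defect a W =
  d%:R *+ 2 - (pauli_overlap a W + ((pauli_overlap a W)^*)%R).
Proof.
move=> Wu; apply: unitary_distance; first exact: pauli_unitary.
exact/conjugate_unitary/pauli_unitary.
Qed.

Lemma pauli_defect_eq0 a W : W \is unitarymx ->
  pauli_defect a W = 0 <-> W *m P a = P a *m W.
Proof.
move=> Wu; split=> [/tr_adjmx_mul_eq0/eqP|WP].
  rewrite subr_eq0 => /eqP WP; rewrite -[in RHS]WP /conjugate.
  by rewrite mulmxKtV.
by rewrite /pauli_defect /conjugate WP mulmxtVK // subrr mul0mx mxtrace0.
Qed.

(** A string is the product of its one-qubit restrictions, and operators commuting with [W] are
    closed under products. Hence the local cost, whose weights are known to be positive on one-qubit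
    strings, constrains [W] as much as the global one. *)
Lemma commute_all_paulis W : W \is unitarymx ->
  (forall j a, supported [:: j] a -> pauli_defect a W = 0) ->
  forall a, pauli_defect a W = 0.
Proof.
move=> Wu W1 a; apply/pauli_defect_eq0 => //.
rewrite pauliE tens_qubits_on_qubits.
have Wj j : W *m on_qubit j (pauli1 R (a.1 j) (a.2 j)) =
    on_qubit j (pauli1 R (a.1 j) (a.2 j)) *m W.
  pose aj : pauli_label n := ([ffun i => (i == j) && a.1 i],
                              [ffun i => (i == j) && a.2 i]).
  have -> : on_qubit j (pauli1 R (a.1 j) (a.2 j)) = P aj.
    rewrite pauliE; apply: eq_tens_qubits => i; rewrite !ffunE.
    by case: eqP => [->|_] //; rewrite pauli1_00.
  apply/pauli_defect_eq0 => //; apply: (W1 j) => i.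
  by rewrite inE !ffunE => /negPf ->.
elim/big_rec: _ => [|j A _ WA]; first by rewrite mulmx1 mul1mx.
by rewrite mulmxA Wj -mulmxA WA mulmxA.
Qed.

(** The Pauli twirl with A = W and B the adjoint of W. *)
Lemma sum_pauli_overlap W :
  \sum_a pauli_overlap a W = d%:R * `|\tr W| ^+ 2.
Proof.
rewrite normCK -tr_adjmx mulrA -(complete_twirl (@pauli_complete R n)).
by apply: eq_bigr => a _; rewrite /pauli_overlap /conjugate !mulmxA.
Qed.

Variable U : 'M[C]_(2 ^ n).
Hypothesis U_unitary : U \is unitarymx.

Lemma target_unitary V : V \is unitarymx -> V ^t* *m U \is unitarymx.
Proof. by move=> Vu; exact: (adj_mul_unitary Vu U_unitary). Qed.

(** The cost is a constant plus a nonnegative combination of defects that vanishes at V = U. The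
    minimizers are therefore its zeros, and a sum of nonnegative terms vanishes only term by
    term. *)
Lemma minimizers_overlap_cost (cost : 'M[C]_(2 ^ n) -> R)
    (w : pauli_label n -> C) :
  (forall a, 0 <= w a) ->
  (forall V, V \is unitarymx ->
     cost V = 1 - complex.Re (\sum_a w a * pauli_overlap a (V ^t* *m U))) ->
  minimizers cost = [set V | V \is unitarymx /\
    forall a, 0 < w a -> pauli_defect a (V ^t* *m U) = 0]%classic.
Proof.
move=> w_ge0 costE.
(* The cost when every overlap attains its largest real part, d. *)
pose kappa := 1 - (\sum_a w a * d%:R).
pose E V := \sum_a w a / 2 * pauli_defect a (V ^t* *m U).
have cost_defect V : V \is unitarymx -> (cost V)%:C = kappa + E V.
  move=> /[dup] Vu /target_unitary Wu; rewrite costE // rmorphB rmorph1 /=.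
  (* Re z is half of z plus its conjugate; the weights are real, so only the overlap gets
     conjugated. *)
  rewrite ReJ_add rmorph_sum -big_split mulr_suml /kappa -addrA -sumrN /E.
  rewrite -sumrN -big_split; congr (1 + _); apply: eq_bigr => a _ /=.
  rewrite rmorphM /= [((w a)^*)%C](conj_Creal (ger0_real (w_ge0 a))).
  by rewrite pauli_defectE //; field.
have E_ge0 V : 0 <= E V.
  by apply: sumr_ge0 => a _; rewrite mulr_ge0 ?divr_ge0 ?pauli_defect_ge0.
have E_U : E U = 0.
  apply: big1 => a _; rewrite (_ : pauli_defect a _ = 0) ?mulr0 //.
  apply/pauli_defect_eq0; first exact: target_unitary.
  by rewrite (mulmx1C (unitarymxP U_unitary)) mul1mx mulmx1.
have E_eq0 V : E V = 0 <->
    forall a, 0 < w a -> pauli_defect a (V ^t* *m U) = 0.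
  have term_ge0 a : 0 <= w a / 2 * pauli_defect a (V ^t* *m U).
    by rewrite mulr_ge0 ?divr_ge0 ?pauli_defect_ge0.
  split=> [EV a wa|EV].
    apply/eqP; move/eqP: EV; rewrite psumr_eq0 // => /allP/(_ a).
    rewrite mem_index_enum => /(_ isT); rewrite !mulf_eq0 invr_eq0 pnatr_eq0.
    by rewrite (gt_eqF wa).
  apply: big1 => a _; have := w_ge0 a; rewrite le_eqVlt.
  by case/orP => [/eqP<-|/EV->]; rewrite ?mul0r ?mulr0.
have cost_le V V' : V \is unitarymx -> V' \is unitarymx ->
    (cost V <= cost V') = (E V <= E V').
  by move=> Vu V'u; rewrite -lecR (cost_defect _ Vu) (cost_defect _ V'u) lerD2l.
apply/seteqP; split=> V /= [Vu].
  move=> V_min; split; [exact: Vu | apply/E_eq0/le_anti].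
  by rewrite E_ge0 andbT -E_U -(cost_le _ _ Vu U_unitary) (V_min _ U_unitary).
move=> /E_eq0 EV; split=> [|V' V'u]; first exact: Vu.
by rewrite (cost_le _ _ Vu V'u) EV.
Qed.

End Twirl.

Section Preparation.
Variables (R : realType) (n : nat) (inf : Prop).
Local Notation C := R[i].
Local Notation d := (2 ^ n)%N.
Local Notation PAB := (@pauliAB R n).

(** The Pauli expansion of the maximally entangled state. *)
Lemma run_entangler_zero_state :
  run (entangler R (enum 'I_n)) (zero_state R n) =
  d%:R ^- 2 *: \sum_a PAB (a, a).
Proof.
rewrite zero_stateE linearZ sum_pair /=; congr (_ *: _).
rewrite linear_sum; apply: eq_bigr => k _; rewrite linear_sum.
apply: eq_bigr => k' _.
by apply: run_entangler => [|i _|i _]; rewrite ?enum_uniq ?mem_enum.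
Qed.

Lemma noisy_preparation gs : List.Forall (good_gate inf) gs ->
  [seq Gg.1 | Gg <- gs] = entangler R (enum 'I_n) ->
  exists q : pauli_label n -> C, (forall a, gain inf (q a)) /\
    noisy_run gs (zero_state R n) = \sum_a q a *: PAB (a, a).
Proof.
move=> gs_good gsE.
have /fin_all_exists[q qP] (a : pauli_label n) :=
  noisy_run_scales (zlabel a.1, zlabel a.2) gs_good.
exists (fun a => d%:R ^- 2 * q a); split=> [a|].
  apply: gainM; last by case: (qP a).
  by apply: gain_gt0; rewrite invr_gt0 exprn_gt0 // ltr0n expn_gt0.
rewrite zero_stateE linearZ sum_pair /= linear_sum scaler_sumr.
apply: eq_bigr => k _; rewrite linear_sum scaler_sumr.
apply: eq_bigr => k' _; rewrite -scalerA; congr (_ *: _).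
case: (qP (k, k')) => _ /= ->; rewrite gsE; congr (_ *: _).
by apply: run_entangler => [|i _|i _]; rewrite ?enum_uniq ?mem_enum.
Qed.

End Preparation.

(** Matches the product W_l ... W_1, indexed through [rev_ord], with the order in which the steps
    are applied. *)
Lemma rev_enum_ord l : rev (enum 'I_l) = [seq rev_ord i | i <- enum 'I_l].
Proof.
apply: (inj_map val_inj); rewrite map_rev val_enum_ord -map_comp.
apply: (@eq_from_nth _ 0%N) => [|i].
  by rewrite size_rev size_iota size_map size_enum_ord.
rewrite size_rev size_iota => i_lt; rewrite nth_rev ?size_iota //.
rewrite nth_iota ?subn_gt0 ?ltn_subrL ?(leq_ltn_trans _ i_lt) //.
rewrite (nth_map (Ordinal i_lt)) ?size_enum_ord //= nth_enum_ord //.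
Qed.

(** * Noisy evolution up to the readout gates *)

Section Middle.
Variables (R : realType) (n : nat) (inf : Prop).
Local Notation C := R[i].
Local Notation d := (2 ^ n)%N.
Local Notation P := (@pauli R n).
Local Notation PAB := (@pauliAB R n).
Variables (U : 'M[C]_(2 ^ n)) (N : noise R n).
Hypothesis N_valid : noise_model2 U N.
Hypothesis N_informative : inf -> informative N.
Implicit Types (a b : pauli_label n) (V X : 'M[C]_(2 ^ n)).

Lemma factor_unitary V i : V \is unitarymx -> factor N V i \is unitarymx.
Proof. by case: N_valid => _ _ _ _ fact /fact[facu _]; exact: facu. Qed.

Lemma prod_factor_unitary V (s : seq 'I_(steps N)) : V \is unitarymx ->
  \big[mulmx/1%:M]_(i <- s) factor N V i \is unitarymx.
Proof.
move=> Vu; elim/big_rec: _ => [|i A _ Au].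
  by apply/unitarymxP; rewrite adjmx1 mulmx1.
exact: (mul_unitarymx (factor_unitary i Vu) Au).
Qed.

(** Conjugation keeps the A factor traceless, which makes the whole product traceless for every [b];
    both depolarizing channels then act as scalars. The factor is chosen before [V]. *)
Lemma noisy_step_pauli (i : 'I_(steps N)) b : exists q, gain inf q /\
  forall V X, V \is unitarymx -> \tr X = 0 ->
  noisy_step V (X *t P b) i = q *: (conjugate (factor N V i) X *t P b).
Proof.
have [_ _ _ /(_ i)[/andP[pA_ge0 _] /andP[pAB_ge0 _] PBi] _] := N_valid.
have [q [q_gain PBE]] : scales inf (PB N i) (P b) (P b).
  apply: (pauli_noise_scales PBi) => hinf.
  by case: (N_informative hinf) => _ _ _ /(_ i)[].
have gain_dep p : 0 <= p -> (informative N -> 0 < p) -> gain inf p%:C.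
  by move=> p0 p1; split=> [|/N_informative/p1]; rewrite ?lecR ?ltcR.
exists (q * (depA N i)%:C * (depAB N i)%:C); split.
  apply: gainM; first apply: gainM => //; apply: gain_dep => // -[_ _ _ /(_ i)].
    by case.
  by case.
move=> V X Vu X0; rewrite /noisy_step tens_chanE PBE tensmxZr linearZ /=.
have WX0 : \tr (conjugate (factor N V i) X) = 0.
  by rewrite (mxtrace_conjugate _ (factor_unitary i Vu)).
rewrite tens_chanE /= (depol_trace0 _ WX0) tensmxZl scalerA.
rewrite [depol _ _]linearZ /=.
by rewrite depol_trace0 ?scalerA // mxtrace_tens WX0 mul0r.
Qed.

Lemma noisy_step1 (i : 'I_(steps N)) V :
  V \is unitarymx -> noisy_step V 1%:M i = 1%:M.
Proof.
move=> /(factor_unitary i) facu.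
have [_ _ _ /(_ i)[_ _ [_ [c [c1 _ PBE]]]] _] := N_valid.
have PB1 : PB N i 1%:M = 1%:M by rewrite -pauli_label0 PBE c1 scale1r.
rewrite /noisy_step -tens1mx1 tens_chanE /= (conjugate1 facu) PB1 tens_chanE /=.
by rewrite depol1 ?expn_gt0 // tens1mx1 depol1 // muln_gt0 expn_gt0.
Qed.

Definition noisy_steps V (s : seq 'I_(steps N)) rho :=
  foldl (noisy_step V) rho s.

Fact noisy_steps_is_linear V s : linear (noisy_steps V s).
Proof.
elim: s => [|i s IH] x A B //=; rewrite /noisy_steps /=.
rewrite -!/(noisy_steps V s _) -IH; congr noisy_steps.
rewrite /noisy_step [tens_chan _ (PB N i) _]linearP.
by rewrite [tens_chan _ idfun _]linearP [LHS]linearP.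
Qed.

HB.instance Definition _ V s := GRing.isLinear.Build C
  'M[C]_(2 ^ n * 2 ^ n) 'M[C]_(2 ^ n * 2 ^ n) _ _ (noisy_steps_is_linear V s).

Lemma noisy_steps_pauli s b : exists q, gain inf q /\
  forall V X, V \is unitarymx -> \tr X = 0 ->
  noisy_steps V s (X *t P b) =
  q *: (conjugate (\big[mulmx/1%:M]_(i <- rev s) factor N V i) X *t P b).
Proof.
elim/last_ind: s => [|s i [q [q_gain qE]]].
  exists 1; split=> [|V X _ _]; first exact: gain_gt0.
  by rewrite big_nil scale1r /conjugate adjmx1 mul1mx mulmx1.
have [r [r_gain rE]] := noisy_step_pauli i b.
exists (q * r); split=> [|V X Vu X0]; first exact: gainM.
rewrite /noisy_steps foldl_rcons -/(noisy_steps V s _) qE //.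
rewrite rev_rcons big_cons conjugateM -scalerA -rE //; last first.
  by rewrite (mxtrace_conjugate _ (prod_factor_unitary _ Vu)).
rewrite -[LHS]/(noisy_steps V [:: i] _) linearZ /=.
by [].
Qed.

Lemma noisy_steps1 V s : V \is unitarymx -> noisy_steps V s 1%:M = 1%:M.
Proof.
move=> Vu; elim: s => [|i s IH] //.
by rewrite /noisy_steps /= noisy_step1.
Qed.

Lemma prod_factor V : V \is unitarymx ->
  \big[mulmx/1%:M]_(i <- rev (enum 'I_(steps N))) factor N V i = V ^t* *m U.
Proof.
move=> Vu; have [_ _ _ _ /(_ V Vu)[_ ->]] := N_valid.
by rewrite rev_enum_ord big_map enumT /index_enum.
Qed.

Lemma mxtrace_adj_pauliAB_tens a b X :
  \tr ((PAB (a, a)) ^t* *m (X *t P b)) =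
  d%:R * \tr ((P a) ^t* *m X) * (a == b)%:R.
Proof.
rewrite /pauliAB adjmx_tens tensmx_mul mxtrace_tens mxtrace_adj_pauli.
by rewrite mulrCA mulrA.
Qed.

(** The B factor [P b] is only rescaled, so pairing with P_a (x) P_a selects a = b, while A is
    conjugated by all of W. The identity string is treated apart because non-unital noise displaces
    it. *)
Lemma noisy_steps_overlap b : exists q, gain inf q /\
  forall V a, V \is unitarymx ->
  \tr ((PAB (a, a)) ^t* *m
       noisy_steps V (enum 'I_(steps N)) (PNU N (P b) *t P b)) =
  q * pauli_overlap a (V ^t* *m U) * (a == b)%:R.
Proof.
have [q [q_gain qE]] := noisy_steps_pauli (enum 'I_(steps N)) b.
have d_gain : gain inf (d%:R : C) by apply: gain_gt0; rewrite ltr0n expn_gt0.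
have [_ _ [_ [_ [c [e [PNU1 c_ge0 PNUE]]]] _] _ _] := N_valid.
have [b0|b0] := eqVneq b (label0 n).
  (* The identity on AB has trace d^2, while the overlap of the identity string is d. *)
  exists d%:R; split=> // V a Vu.
  pose Y := \sum_(a | a != label0 n) e a *: P a.
  have Y0 : \tr Y = 0.
    rewrite raddf_sum big1 // => a' a'0.
    by rewrite /= mxtraceZ mxtrace_pauli (negPf a'0) !mulr0.
  have -> : PNU N (P b) *t P b = 1%:M + Y *t P b.
    by rewrite b0 pauli_label0 PNU1 tensmxDl tens1mx1.
  rewrite linearD /= noisy_steps1 // qE // prod_factor //.
  have Wu : V ^t* *m U \is unitarymx.
    by rewrite -(prod_factor Vu) (prod_factor_unitary _ Vu).
  have E1 : \tr ((PAB (a, a)) ^t* *m 1%:M) =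
      d%:R * pauli_overlap a (V ^t* *m U) * (a == b)%:R.
    rewrite mulmx1 tr_adjmx mxtrace_pauliAB xpair_eqE andbb b0.
    have [->|_] := eqVneq a; last by rewrite !mulr0 rmorph0.
    rewrite /pauli_overlap pauli_label0 adjmx1 mul1mx conjugate1 //.
    by rewrite mxtrace1 !mulr1 rmorphXn rmorph_nat expr2.
  (* The displacement is orthogonal to P_a (x) P_a: on B if [a] is not the identity label, and on A
     by tracelessness if it is. *)
  have E2 : \tr ((PAB (a, a)) ^t* *m (conjugate (V ^t* *m U) Y *t P b)) = 0.
    rewrite mxtrace_adj_pauliAB_tens b0.
    have [->|_] := eqVneq a; last exact: mulr0.
    rewrite pauli_label0 adjmx1 mul1mx (mxtrace_conjugate _ Wu) Y0.
    by rewrite mulr0 mul0r.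
  by rewrite mulmxDr mxtraceD E1 -scalemxAr mxtraceZ E2 mulr0 addr0.
have [r [r_gain rE]] : scales inf (PNU N) (P b) (P b).
  exists (c b)%:C; split; last exact: PNUE.
  split=> [|/N_informative[_ _ [_ /(_ b) cb _] _]]; first by rewrite lecR c_ge0.
  rewrite (ltcR 0) lt_neqAle c_ge0 // andbT; apply/eqP => c0; apply: cb.
  by rewrite PNUE // -c0 scale0r.
(* The factors come from the non-unital noise, the steps and the trace over B. *)
exists (r * q * d%:R); split=> [|V a Vu]; first by do 2?apply: gainM.
rewrite rE tensmxZl linearZ /= qE ?mxtrace_pauli ?(negPf b0) ?mulr0 //.
rewrite prod_factor // -!scalemxAr !mxtraceZ mxtrace_adj_pauliAB_tens.
have assoc (x y z t t' : C) (ab : bool) : (ab -> t = t') ->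
    x * (y * (z * t * ab%:R)) = x * y * z * t' * ab%:R.
  by case: ab => [->|_] //; rewrite ?mulr0 // !mulrA.
by apply: assoc => /eqP->.
Qed.

(** Preparation and [Q1] are followed on the state, a combination of strings P_b (x) P_b.
    Conjugation by W turns these into general operators, so [Q2] is instead moved onto the tested
    string. *)
Lemma noisy_middle_overlap : exists w : pauli_label n -> C,
  (forall a, gain inf (w a)) /\
  forall V a, V \is unitarymx ->
    \tr ((PAB (a, a)) ^t* *m noisy_middle N V) =
    w a * pauli_overlap a (V ^t* *m U).
Proof.
have [gate1 gate2 [Q1N _ Q2N] _ _] := N_valid.
pose gs := [seq (gateH R j, prepH N j) | j <- enum 'I_n] ++
           [seq (gateCNOT R j, prepCNOT N j) | j <- enum 'I_n].
have [||q [q_gain qE]] := @noisy_preparation R n inf gs.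
- apply/List.Forall_app; split; apply: Forall_map => j; split=> /=.
  + exact: clifford_gateH.
  + by case: (gate1 j).
  + by move=> /N_informative[/(_ j)[]].
  + exact: clifford_gateCNOT.
  + by case: (gate1 j).
  + by move=> /N_informative[/(_ j)[]].
- by rewrite /gs map_cat -[X in X ++ _]map_comp -[X in _ ++ X]map_comp.
have Q1_scales ab : scales inf (Q1 N) (PAB ab) (PAB ab).
  by apply: (pauli_noise_scales Q1N) => /N_informative[_ _ []].
have Q2_scales ab : scales inf (Q2 N) (PAB ab) (PAB ab).
  by apply: (pauli_noise_scales Q2N) => /N_informative[_ _ []].
have /fin_all_exists[r rP] a := Q1_scales (a, a).
have /fin_all_exists[t tP] a := mxtrace_adj_pauli_scales Q2_scales (a, a).
have /fin_all_exists[u uP] := noisy_steps_overlap.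
exists (fun a => t a * (q a * r a * u a)); split=> [a|V a Vu].
  case: (rP a) (tP a) (uP a) => r_gain _ [t_gain _] [u_gain _].
  by apply: gainM => //; apply: gainM => //; apply: gainM.
have termE b : \tr ((PAB (a, a)) ^t* *m noisy_steps V (enum 'I_(steps N))
      (tens_chan (PNU N) idfun (Q1 N (q b *: PAB (b, b))))) =
    q b * (r b * (u b * pauli_overlap a (V ^t* *m U) * (a == b)%:R)).
  rewrite [Q1 N _]linearZ /=; case: (rP b) => _ ->.
  rewrite [tens_chan _ _ _]linearZ /= [tens_chan _ _ _]linearZ /=.
  rewrite /pauliAB tens_chanE /= [noisy_steps _ _ _]linearZ /=.
  rewrite [noisy_steps _ _ _]linearZ /= -!scalemxAr !mxtraceZ.
  by case: (uP b) => _ ->.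
rewrite /noisy_middle -/gs; case: (tP a) => _ ->; rewrite -[RHS]mulrA.
congr (_ * _); rewrite qE -/(noisy_steps V _ _).
rewrite [Q1 N _]linear_sum [tens_chan _ _ _]linear_sum.
rewrite [noisy_steps _ _ _]linear_sum mulmx_sumr raddf_sum.
rewrite (bigD1 a) //= big1 => [|b ba].
  by rewrite addr0 [LHS]termE eqxx mulr1 !mulrA.
by rewrite [LHS]termE eq_sym (negPf ba) !mulr0.
Qed.

End Middle.

(** * Weights of the noiseless and noisy costs *)

Section Costs.
Variables (R : realType) (n : nat).
Local Notation C := R[i].
Local Notation d := (2 ^ n)%N.
Local Notation P := (@pauli R n).
Local Notation PAB := (@pauliAB R n).
Variable U : 'M[C]_(2 ^ n).
Implicit Types (a b : pauli_label n) (V : 'M[C]_(2 ^ n)) (j : 'I_n).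

Definition overlap_sum (w : pauli_label n -> C) V : R :=
  complex.Re (\sum_a w a * pauli_overlap a (V ^t* *m U)).

Lemma dim_gt0 : 0 < d%:R :> C.
Proof. by rewrite ltr0n expn_gt0. Qed.

Lemma C_HST_overlap V : C_HST U V = 1 - overlap_sum (fun=> d%:R ^- 3) V.
Proof.
rewrite /C_HST /overlap_sum -mulr_sumr sum_pauli_overlap.
congr (1 - complex.Re _); rewrite mulrA mulrC; congr (_ * _).
rewrite (exprS _ 2) [in RHS]invfM [RHS]mulrAC mulVf ?mul1r //.
by rewrite gt_eqF // dim_gt0.
Qed.

Lemma mean_overlap_sum (F : 'I_n -> R) (w : 'I_n -> pauli_label n -> C) V :
  (forall j, F j = overlap_sum (w j) V) ->
  n%:R^-1 * \sum_j F j =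
  overlap_sum (fun a => (n%:R^-1)%:C * \sum_j w j a) V.
Proof.
move=> FE.
have Re_real (x : R) (z : C) : x * complex.Re z = complex.Re (x%:C * z).
  by case: z => u v; rewrite /= mul0r subr0.
rewrite (eq_bigr _ (fun j _ => FE j)) /overlap_sum -raddf_sum Re_real.
congr complex.Re; rewrite exchange_big mulr_sumr; apply: eq_bigr => a _ /=.
by rewrite -mulr_suml mulrA.
Qed.

Lemma F_LHST_overlap j : exists w : pauli_label n -> C,
  [/\ forall a, 0 <= w a, forall a, supported [:: j] a -> 0 < w a
    & forall V, F_LHST U j V = overlap_sum w V].
Proof.
have /bell_diagonal_pairing[o [o_ge0 o_gt0 oE]] :=
  bell_diagonal_on_qubit j (z_diagonal_ketbra0 R) (z_diagonal_ketbra0 R).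
(* The entangled state contributes d^-2 and the trace over B contributes d. *)
exists (fun a => o a * d%:R^-1); split.
- by move=> a; rewrite mulr_ge0 // invr_ge0 ltW // dim_gt0.
- by move=> a /o_gt0 oa; rewrite mulr_gt0 // invr_gt0 dim_gt0.
move=> V; rewrite /F_LHST /overlap_sum catA run_cat run_entangler_zero_state.
(* The last two gates are, by computation, the inverse of the entangler on the list [[:: j]]. *)
rewrite run_cons -[[:: _; _]]/[seq G ^t* | G <- rev (entangler R [:: j])].
rewrite mxtrace_mul_run_adj oE; congr complex.Re; apply: eq_bigr => a _.
have termE b : \tr ((PAB (a, a)) ^t* *m
    conjugate ((V ^t* *m U) *t 1%:M) (PAB (b, b))) =
    d%:R * \tr ((P a) ^t* *m conjugate (V ^t* *m U) (P b)) * (a == b)%:R.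
  rewrite /pauliAB conjugate_tens [conjugate 1%:M _]/conjugate adjmx1 mul1mx.
  by rewrite mulmx1 mxtrace_adj_pauliAB_tens.
have sumE : \tr ((PAB (a, a)) ^t* *m
    conjugate ((V ^t* *m U) *t 1%:M) (\sum_b PAB (b, b))) =
    d%:R * pauli_overlap a (V ^t* *m U).
  rewrite [conjugate _ _]linear_sum mulmx_sumr raddf_sum (bigD1 a) //=.
  rewrite big1 => [|b ba]; first by rewrite addr0 [LHS]termE eqxx mulr1.
  by rewrite [LHS]termE eq_sym (negPf ba) mulr0.
have cancel_dim (x y z : C) : y != 0 -> x * (y ^- 2 * (y * z)) = x * y^-1 * z.
  by move=> y0; rewrite expr2 invfM -!mulrA mulKf.
rewrite [conjugate _ _]linearZ /= -scalemxAr mxtraceZ sumE.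
by apply: cancel_dim; rewrite gt_eqF // dim_gt0.
Qed.

Variables (N : noise R n).
Hypothesis N_valid : noise_model2 U N.

Lemma noisy_C_HST_overlap : exists w : pauli_label n -> C,
  [/\ forall a, 0 <= w a, informative N -> forall a, 0 < w a
    & forall V, V \is unitarymx -> noisy_C_HST N V = 1 - overlap_sum w V].
Proof.
(* The argument [id] instantiates [inf] with [informative N]. *)
have [w [w_gain wE]] := @noisy_middle_overlap R n _ U N N_valid id.
have [gate1 gate2 _ _ _] := N_valid.
pose gs := [seq ((gateCNOT R j) ^t*, hstCNOT N j) | j <- rev (enum 'I_n)] ++
           [seq ((gateH R j) ^t*, hstH N j) | j <- rev (enum 'I_n)].
have gs_good : List.Forall (good_gate (informative N)) gs.
  apply/List.Forall_app; split; apply: Forall_map => j; split=> /=.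
  - by rewrite adj_gateCNOT; apply: clifford_gateCNOT.
  - by case: (gate1 j).
  - by case=> /(_ j)[].
  - by rewrite adj_gateH; apply: clifford_gateH.
  - by case: (gate1 j).
  - by case=> /(_ j)[].
have gsE : [seq Gg.1 | Gg <- gs] =
    [seq G ^t* | G <- rev (entangler R (enum 'I_n))].
  rewrite /gs /entangler rev_cat !map_cat -!map_rev -[X in X ++ _]map_comp.
  rewrite -[X in _ ++ X]map_comp -[X in _ = X ++ _]map_comp.
  by rewrite -[X in _ = _ ++ X]map_comp.
have [|o [o_ge0 o_gt0 oE]] := noisy_measurement (O := tens_qubits
    (fun j => readout0 (readA N j)) *t tens_qubits
    (fun j => readout0 (readB N j))) _ gs_good gsE.
  apply: z_diagonal_tens => [|j|j]; rewrite ?enum_uniq ?mem_enum //;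
    by apply: z_diagonal_readout0; case: (gate2 j).
exists (fun a => o a * w a); split.
- by move=> a; rewrite mulr_ge0 //; case: (w_gain a).
- move=> hinf a; apply: mulr_gt0; last by case: (w_gain a) => _; apply.
  by apply: o_gt0 => // i; rewrite mem_enum.
move=> V Vu; rewrite /noisy_C_HST /noisy_F_HST oE /overlap_sum.
congr (1 - complex.Re _); apply: eq_bigr => a _.
by rewrite (wE V a Vu) mulrA.
Qed.

Lemma noisy_F_LHST_overlap j : exists w : pauli_label n -> C,
  [/\ forall a, 0 <= w a,
      informative N -> forall a, supported [:: j] a -> 0 < w a
    & forall V, V \is unitarymx -> noisy_F_LHST N j V = overlap_sum w V].
Proof.
have [w [w_gain wE]] := @noisy_middle_overlap R n _ U N N_valid id.
have [gate1 gate2 _ _ _] := N_valid.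
pose gs := [:: ((gateCNOT R j) ^t*, lhstCNOT N j);
               ((gateH R j) ^t*, lhstH N j)].
have gs_good : List.Forall (good_gate (informative N)) gs.
  constructor; [|constructor; [|by []]]; split=> /=.
  - by rewrite adj_gateCNOT; apply: clifford_gateCNOT.
  - by case: (gate2 j).
  - by case=> _ /(_ j)[].
  - by rewrite adj_gateH; apply: clifford_gateH.
  - by case: (gate2 j).
  - by case=> _ /(_ j)[].
have [readAj readBj] : valid_readout (readA N j) /\ valid_readout (readB N j).
  by case: (gate2 j).
have [o [o_ge0 o_gt0 oE]] := noisy_measurement (bell_diagonal_on_qubit j
  (z_diagonal_readout0 readAj) (z_diagonal_readout0 readBj)) gs_good erefl.
exists (fun a => o a * w a); split.
- by move=> a; rewrite mulr_ge0 //; case: (w_gain a).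
- move=> hinf a a_supp; apply: mulr_gt0; first exact: o_gt0.
  by case: (w_gain a) => _; apply.
move=> V Vu; rewrite /noisy_F_LHST oE /overlap_sum.
congr complex.Re; apply: eq_bigr => a _.
by rewrite (wE V a Vu) mulrA.
Qed.

End Costs.

(** Valid noise keeps all weights nonnegative, so noiseless minimizers stay optimal. The reverse
    inclusion uses positive weights on the one-qubit strings, which informative noise guarantees. *)
Theorem theorem2 (R : realType) (n : nat) (hn : (0 < n)%N)
    (U : 'M[R[i]]_(2 ^ n)) (hU : U \is unitarymx)
    (N : noise R n) (hN : noise_model2 U N) :
  [/\ (minimizers (C_HST U) `<=` minimizers (noisy_C_HST N))%classic,
      (minimizers (C_LHST U) `<=` minimizers (noisy_C_LHST N))%classic
    & informative N ->
      strong_OPR (C_HST U) (noisy_C_HST N) /\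
      strong_OPR (C_LHST U) (noisy_C_LHST N)].
Proof.
(* The unitaries for which W commutes with every Pauli string, that is, those equal to U up to a
   phase. *)
pose opt := [set V : 'M[R[i]]_(2 ^ n) | V \is unitarymx /\
  forall a, pauli_defect a (V ^t* *m U) = 0]%classic.
have opt_sub cost (w : pauli_label n -> R[i]) : (forall a, 0 <= w a) ->
    (forall V, V \is unitarymx -> cost V = 1 - overlap_sum U w V) ->
    (opt `<=` minimizers cost)%classic.
  move=> w_ge0 costE; rewrite (minimizers_overlap_cost hU w_ge0 costE).
  by move=> V [Vu V0]; split=> [|a _]; [exact: Vu | exact: V0].
have opt_eq cost (w : pauli_label n -> R[i]) : (forall a, 0 <= w a) ->
    (forall j a, supported [:: j] a -> 0 < w a) ->
    (forall V, V \is unitarymx -> cost V = 1 - overlap_sum U w V) ->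
    minimizers cost = opt.
  move=> w_ge0 w_gt0 costE; apply/seteqP; split; last exact: opt_sub costE.
  rewrite (minimizers_overlap_cost hU w_ge0 costE) => V [Vu V0].
  split; first exact: Vu.
  apply: commute_all_paulis; first exact: (target_unitary hU Vu).
  by move=> j a /w_gt0; exact: V0.
have mean_ge0 (w : 'I_n -> pauli_label n -> R[i]) :
    (forall j a, 0 <= w j a) -> forall a, 0 <= (n%:R^-1)%:C * \sum_j w j a.
  move=> w_ge0 a; rewrite mulr_ge0 ?lecR ?invr_ge0 ?ler0n //.
  exact: sumr_ge0.
have mean_gt0 (w : 'I_n -> pauli_label n -> R[i]) :
    (forall j a, 0 <= w j a) -> (forall j a, supported [:: j] a -> 0 < w j a) ->
    forall j a, supported [:: j] a -> 0 < (n%:R^-1)%:C * \sum_j w j a.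
  move=> w_ge0 w_gt0 j a a_supp.
  rewrite mulr_gt0 ?(ltcR 0) ?invr_gt0 ?ltr0n // (bigD1 j) //=.
  by rewrite ltr_pwDl ?(w_gt0 _ _ a_supp) ?sumr_ge0.
have HST_opt : minimizers (C_HST U) = opt.
  have w_gt0 : 0 < (2 ^ n)%:R ^- 3 :> R[i].
    by rewrite invr_gt0 exprn_gt0 // dim_gt0.
  apply: (opt_eq _ (fun=> _) (fun=> ltW w_gt0) (fun _ _ _ => w_gt0)) => V _.
  exact: C_HST_overlap.
have LHST_opt : minimizers (C_LHST U) = opt.
  have /fin_all_exists[w wP] := F_LHST_overlap U.
  have w_ge0 j a : 0 <= w j a by case: (wP j).
  have w_gt0 j a : supported [:: j] a -> 0 < w j a.
    by case: (wP j) => _ + _; apply.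
  apply: (opt_eq _ _ (mean_ge0 w w_ge0) (mean_gt0 w w_ge0 w_gt0)) => V _.
  congr (1 - _); apply: mean_overlap_sum => j.
  by case: (wP j).
have [wH [wH_ge0 wH_gt0 HE]] := noisy_C_HST_overlap hN.
have /fin_all_exists[wL wLP] := noisy_F_LHST_overlap hN.
have wL_ge0 j a : 0 <= wL j a by case: (wLP j).
have LE V : V \is unitarymx -> noisy_C_LHST N V =
    1 - overlap_sum U (fun a => (n%:R^-1)%:C * \sum_j wL j a) V.
  move=> Vu; congr (1 - _); apply: mean_overlap_sum => j.
  by case: (wLP j) => _ _; apply.
rewrite /strong_OPR HST_opt LHST_opt; split=> [||inf].
- exact: opt_sub wH_ge0 HE.
- exact: opt_sub (mean_ge0 _ wL_ge0) LE.
split; first by apply: opt_eq wH_ge0 _ HE => j a _; exact: wH_gt0.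
apply: opt_eq (mean_ge0 _ wL_ge0) (mean_gt0 _ wL_ge0 _) LE => j a.
by case: (wLP j) => _ /(_ inf) wL_gt0 _; exact: wL_gt0.
Qed.
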